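(* Let $E\subset\mathbb{R}^d$ be a Moran set with $c_*=\inf_{k,j}c_{k,j}>0$. Then, for every $\theta\in[0,1]$, the upper and lower $\theta$-intermediate dimensions of $E$ are given by $$\overline{\dim}_\theta E=s^\theta,\qquad \underline{\dim}_\theta E=s_\theta .$$
   Context: Intermediate dimensions. $|\cdot|$ denotes the diameter of a set. For $E\subset\mathbb{R}^d$ and $0\le\theta\le1$ (with $\delta^{1/\theta}$ read as $0$ when $\theta=0$, so that both dimensions equal the Hausdorff dimension $\dim_H E$): $\underline{\dim}_\theta E=\inf\{s\ge0:$ for all $\varepsilon>0$ and $\Delta>0$ there exist $0<\delta\le\Delta$ and a cover $\{U_i\}$ of $E$ such that $\delta^{1/\theta}\le|U_i|\le\delta$ for all $i$ and $\sum|U_i|^s\le\varepsilon\}$; $\overline{\dim}_\theta E=\inf\{s\ge0:$ for all $\varepsilon>0$ there exists $\Delta>0$ such that for all $0<\delta\le\Delta$ there is a cover $\{U_i\}$ of $E$ such that $\delta^{1/\theta}\le|U_i|\le\delta$ for all $i$ and $\sum|U_i|^s\le\varepsilon\}$. Words and cut sets. Let $\{n_k\}_{k\ge1}$ be integers $\ge2$. $\Sigma^k=\{u_1\cdots u_k:1\le u_j\le n_j\}$, $\Sigma^0=\{\emptyset\}$, $\Sigma^*=\bigcup_{k\ge0}\Sigma^k$, $\Sigma^\infty=\{u_1u_2\cdots:1\le u_k\le n_k\}$. For $\mathbf{u}=u_1\cdots u_k\in\Sigma^*$ with $k\ge1$, $\mathbf{u}^*=u_1\cdots u_{k-1}$.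 A set $A\subset\Sigma^*$ is a cut set if every $\mathbf{w}\in\Sigma^\infty$ has exactly one element of $A$ as a prefix. Moran sets. Let $J\subset\mathbb{R}^d$ be compact with nonempty interior, and let $\phi_k=(c_{k,1},\dots,c_{k,n_k})$, $k\ge1$, be positive real vectors with $\sum_{j=1}^{n_k}(c_{k,j})^d\le1$. Let $\{J_{\mathbf{u}}:\mathbf{u}\in\Sigma^*\}$ be closed subsets of $J$ such that: (1) for each $\mathbf{u}$ there is a similarity $\Psi_{\mathbf{u}}:\mathbb{R}^d\to\mathbb{R}^d$ with $J_{\mathbf{u}}=\Psi_{\mathbf{u}}(J)$, and $J_\emptyset=J$; (2) for all $k\ge1$ and $\mathbf{u}\in\Sigma^{k-1}$, the sets $J_{\mathbf{u}1},\dots,J_{\mathbf{u}n_k}$ are subsets of $J_{\mathbf{u}}$ with pairwise disjoint interiors and $|J_{\mathbf{u}i}|/|J_{\mathbf{u}}|=c_{k,i}$ for $1\le i\le n_k$. Then $E=\bigcap_{k\ge1}\bigcup_{\mathbf{u}\in\Sigma^k}J_{\mathbf{u}}$ is called a Moran set. The numbers $s^\theta,s_\theta$. For $\delta>0$ and $\theta\in(0,1]$, $$s_{\delta,\theta}=\min\Big\{s:\sum_{\mathbf{u}\in\mathcal{M}}|J_{\mathbf{u}}|^s=1,\ \text{where }\mathcal{M}\text{ is a cut set such that }\delta^{1/\theta}<|J_{\mathbf{u}^*}|\text{ and }|J_{\mathbf{u}}|\le\delta\text{ for each }\mathbf{u}\in\mathcal{M}\Big\},$$ $s^\theta=\limsup_{\delta\to0}s_{\delta,\theta}$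 and $s_\theta=\liminf_{\delta\to0}s_{\delta,\theta}$. For $\theta=0$, $s^\theta=s_\theta=s_*$, where $s_*=\liminf_{m\to\infty}s_m$ and $s_m$ is the unique real solution $s$ of $\prod_{i=1}^m\big(\sum_{j=1}^{n_i}(c_{i,j})^s\big)=1$. *)

(* Defs.v *)
From HB Require Import structures.
From mathcomp Require Import all_boot all_order all_algebra.
From mathcomp Require Import all_classical all_reals all_analysis.

Set Implicit Arguments.
Unset Strict Implicit.
Unset Printing Implicit Defensive.

Import Order.TTheory GRing.Theory Num.Theory.
Import numFieldNormedType.Exports.

Local Open Scope classical_set_scope.
Local Open Scope ring_scope.

(* R^d is 'rV[R]_d.  The library norm on matrices is the max norm, so the
   Euclidean distance is defined here; the topologies coincide. *)
Definition edist (R : realType) (d : nat) (x y : 'rV[R]_d) : R :=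
  Num.sqrt (\sum_(i < d) (x 0 i - y 0 i) ^+ 2).

(* Extended-real valued, so that unbounded sets have diameter +oo; adding 0
   to the set makes the diameter of the empty set 0 instead of -oo. *)
Definition diam (R : realType) (d : nat) (A : set 'rV[R]_d) : \bar R :=
  ereal_sup ([set 0%E] `|` [set (edist x y)%:E | x in A & y in A]).

Definition is_similarity (R : realType) (d : nat)
    (f : 'rV[R]_d -> 'rV[R]_d) : Prop :=
  exists2 r : R, 0 < r & forall x y, edist (f x) (f y) = r * edist x y.

(* delta^(1/theta), read as 0 when theta = 0 *)
Definition scale_root (R : realType) (delta theta : R) : R :=
  if theta == 0 then 0 else delta `^ (theta^-1).

(* A finite or countable cover {U_i : i in I}, I a set of naturals, of E by
   sets with delta^(1/theta) <= |U_i| <= delta and sum_i |U_i|^s <= eps. *)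
Definition has_cover (R : realType) (d : nat) (E : set 'rV[R]_d)
    (theta s eps delta : R) : Prop :=
  exists (I : set nat) (U : nat -> set 'rV[R]_d),
    [/\ E `<=` \bigcup_(i in I) U i,
        forall i, I i ->
          ((scale_root delta theta)%:E <= diam (U i) <= delta%:E)%E
      & (\esum_(i in I) (diam (U i) `^ s) <= eps%:E)%E].

Definition lower_idim (R : realType) (d : nat) (theta : R)
    (E : set 'rV[R]_d) : \bar R :=
  ereal_inf [set s%:E | s in [set s : R | 0 <= s /\
    forall eps Delta : R, 0 < eps -> 0 < Delta ->
      exists delta : R, 0 < delta <= Delta /\
        has_cover E theta s eps delta]].

Definition upper_idim (R : realType) (d : nat) (theta : R)
    (E : set 'rV[R]_d) : \bar R :=
  ereal_inf [set s%:E | s in [set s : R | 0 <= s /\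
    forall eps : R, 0 < eps ->
      exists Delta : R, 0 < Delta /\
        forall delta : R, 0 < delta <= Delta ->
          has_cover E theta s eps delta]].

(* Levels and letters are numbered from 0: n k is n_{k+1}, the (k+1)-st letter
   of a word ranges over 0, ..., n k - 1, and c k j is c_{k+1,j+1}. *)
Definition is_word (n : nat -> nat) (u : seq nat) : Prop :=
  forall i, (i < size u)%N -> (nth 0%N u i < n i)%N.

Definition is_inf_word (n : nat -> nat) (w : nat -> nat) : Prop :=
  forall i, (w i < n i)%N.

(* u^* : u without its last letter; u^* is not defined for the
   empty word, where this returns the empty word. *)
Definition parent (u : seq nat) : seq nat := take (size u).-1 u.

Definition inf_prefix (u : seq nat) (w : nat -> nat) : Prop :=
  u = mkseq w (size u).

Definition cut_set (n : nat -> nat) (A : set (seq nat)) : Prop :=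
  A `<=` is_word n /\
  forall w, is_inf_word n w -> exists! u, A u /\ inf_prefix u w.

Record moran_structure (R : realType) (d : nat) (n : nat -> nat)
    (c : nat -> nat -> R) (J : set 'rV[R]_d)
    (Js : seq nat -> set 'rV[R]_d) : Prop := MoranStructure {
  moran_n_ge2 : forall k, (2 <= n k)%N;
  moran_J_compact : compact J;
  moran_J_interior : J° !=set0;
  moran_c_gt0 : forall k j, (j < n k)%N -> 0 < c k j;
  moran_c_sum : forall k, \sum_(j < n k) c k j ^+ d <= 1;
  moran_closed : forall u, is_word n u -> closed (Js u) /\ Js u `<=` J;
  moran_similar : forall u, is_word n u ->
    exists2 Psi : 'rV[R]_d -> 'rV[R]_d, is_similarity Psi & Js u = Psi @` J;
  moran_root : Js [::] = J;
  moran_sub : forall u i, is_word n u -> (i < n (size u))%N ->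
    Js (rcons u i) `<=` Js u;
  moran_disjoint : forall u, is_word n u ->
    trivIset [set i | (i < n (size u))%N] (fun i => (Js (rcons u i))°);
  moran_ratio : forall u i, is_word n u -> (i < n (size u))%N ->
    fine (diam (Js (rcons u i))) / fine (diam (Js u)) = c (size u) i
}.

Definition moran_set (R : realType) (d : nat) (n : nat -> nat)
    (Js : seq nat -> set 'rV[R]_d) : set 'rV[R]_d :=
  \bigcap_(k in [set k | (1 <= k)%N])
    \bigcup_(u in [set u | is_word n u /\ size u = k]) Js u.

Definition c_star (R : realType) (n : nat -> nat) (c : nat -> nat -> R) : R :=
  inf [set x | exists k j, (j < n k)%N /\ x = c k j].

(* The least element of A, or 0 if there is none. *)
Definition set_min (R : realType) (A : set R) : R :=
  xget 0 [set s | A s /\ forall t, A t -> s <= t].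

Definition admissible_cut (R : realType) (d : nat) (n : nat -> nat)
    (Js : seq nat -> set 'rV[R]_d) (delta theta : R)
    (M : set (seq nat)) : Prop :=
  cut_set n M /\
  forall u, M u -> ((scale_root delta theta)%:E < diam (Js (parent u)))%E /\
                   (diam (Js u) <= delta%:E)%E.

Definition s_delta (R : realType) (d : nat) (n : nat -> nat)
    (Js : seq nat -> set 'rV[R]_d) (theta delta : R) : R :=
  set_min [set s : R | exists M, admissible_cut n Js delta theta M /\
                         (\esum_(u in M) (diam (Js u) `^ s) = 1)%E].

(* s_m, the solution s of prod_(i<m) sum_(j<n_i) c_(i,j)^s = 1, which is
   unique for m >= 1; the value at m = 0 is irrelevant. *)
Definition s_level (R : realType) (n : nat -> nat) (c : nat -> nat -> R)
    (m : nat) : R :=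
  xget 0 [set s : R | \prod_(i < m) (\sum_(j < n i) c i j `^ s) = 1].

Definition s_star (R : realType) (n : nat -> nat) (c : nat -> nat -> R) :
    \bar R :=
  limn_einf (fun m => (s_level n c m)%:E).

Definition s_upper (R : realType) (d : nat) (n : nat -> nat)
    (c : nat -> nat -> R) (Js : seq nat -> set 'rV[R]_d) (theta : R) : \bar R :=
  if theta == 0 then s_star n c
  else limf_esup (fun delta => (s_delta n Js theta delta)%:E) (0 : R)^'+.

Definition s_lower (R : realType) (d : nat) (n : nat -> nat)
    (c : nat -> nat -> R) (Js : seq nat -> set 'rV[R]_d) (theta : R) : \bar R :=
  if theta == 0 then s_star n c
  else limf_einf (fun delta => (s_delta n Js theta delta)%:E) (0 : R)^'+.

(* Main.v *)
Require Import Defs.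
From HB Require Import structures.
From mathcomp Require Import all_boot all_order all_algebra.
From mathcomp Require Import all_classical all_reals all_analysis.
From mathcomp Require Import ring lra.
Import Order.TTheory GRing.Theory Num.Theory.
Import numFieldNormedType.Exports.
Import Defs.
Local Open Scope classical_set_scope.
Local Open Scope ring_scope.

Set Implicit Arguments.
Unset Strict Implicit.
Unset Printing Implicit Defensive.

(** Covers of a Moran set E and sets of words are two descriptions of the same
thing, up to constants that do not depend on the scale; the theorem is this
dictionary.

From covers to words.  Let sets U_i cover E and fix radii r_i >= |U_i|.  The
cells J_u that meet U_i and are the first on their branch to have diameter at
most r_i have diameter comparable to r_i and disjoint interiors, and each
contains a ball of comparable radius; so a volume-type argument ([packing],
[few_cells]) bounds their number by a constant N.  Every branch of the tree of
words ends in a point of E, which lies in some U_i; hence the words u so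
obtained meet every branch, and the sum of the |J_u|^s is at most N times the
sum of the r_i^s ([cover_bar]).  Suppose that the latter sum is small.  When
theta > 0 the words minimal for the prefix order form an admissible cut set M
on which the sum of |J_u|^s is at most 1, and so s_(delta,theta) <= s, because
the sum decreases in s ([cover_s_delta]).
When theta = 0 the words have no bounded length; comparing with the weights
c_u^s / P_k(s), for words u of length k, where P_k(s) is the sum of c_v^s over
the words v of length k, shows that P_k(s) <= 1 for the length k of one of
them, that is, s_k <= s ([bar_level], [cover_s_level]).

From words to covers.  If M is a cut set with the sum of |J_u|^t equal to 1 and
all |J_u| <= eta, then for s > t the sum of |J_u|^s is at most eta^(s-t), which
is small with eta ([powsum_le]).  The cells J_u, u in M, cover E.  For theta = 0
the cells of a level m with s_m < s are the cover ([s_level_has_cover]).  For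
theta > 0 a cell may be too small, its parent only being larger than
eta^(1/theta); replacing it by a ball of the right diameter costs a bounded
factor since c_* > 0, and working with eta = delta/2 keeps the balls below
delta ([s_delta_has_cover]).

Both dimensions are then compared with the upper and lower limits by testing
against real numbers s ([ereal_inf_eq]). *)

(** * Euclidean distance and similarities *)

Section Euclid.
Context (R : realType) (d : nat).
Implicit Types (x y z : 'rV[R]_d) (A B : set 'rV[R]_d).

Lemma edist_ge0 x y : 0 <= edist x y.
Proof. exact: sqrtr_ge0. Qed.

Lemma edistxx x : edist x x = 0.
Proof. by rewrite /edist big1 ?sqrtr0// => i _; rewrite subrr expr0n. Qed.

Lemma edistC x y : edist x y = edist y x.
Proof. by congr Num.sqrt; apply: eq_bigr => i _; rewrite -sqrrN opprB. Qed.

Lemma edist_sqr x y : edist x y ^+ 2 = \sum_(i < d) (x 0 i - y 0 i) ^+ 2.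
Proof. by rewrite sqr_sqrtr// sumr_ge0// => i _; exact: sqr_ge0. Qed.

Lemma edist_coord x y i : `|x 0 i - y 0 i| <= edist x y.
Proof.
rewrite -sqrtr_sqr ler_wsqrtr// (bigD1 i)//= lerDl sumr_ge0// => j _.
exact: sqr_ge0.
Qed.

(** With A, B and P the sums of the a_i^2, the b_i^2 and the a_i b_i, the sum of
the squares of B a_i - P b_i is nonnegative and equals B (A B - P^2), which
settles the case B > 0; if B = 0 then b = 0. *)
Lemma cauchy_schwarz (a b : 'I_d -> R) :
  (\sum_i a i * b i) ^+ 2 <= (\sum_i a i ^+ 2) * (\sum_i b i ^+ 2).
Proof.
set P := \sum_i a i * b i; set A := \sum_i a i ^+ 2; set B := \sum_i b i ^+ 2.
have B0 : 0 <= B by apply: sumr_ge0 => i _; exact: sqr_ge0.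
have : 0 <= \sum_i (B * a i - P * b i) ^+ 2.
  by apply: sumr_ge0 => i _; exact: sqr_ge0.
have -> : \sum_i (B * a i - P * b i) ^+ 2 = B * (A * B - P ^+ 2).
  transitivity (\sum_i (B ^+ 2 * a i ^+ 2 + (- (2 * B * P)) * (a i * b i)
                         + P ^+ 2 * b i ^+ 2)).
    by apply: eq_bigr => i _; ring.
  by rewrite !big_split/= -!mulr_sumr -/A -/B -/P; ring.
move: B0; rewrite le_eqVlt => /predU1P[B0 _|B0]; last first.
  by rewrite pmulr_rge0// subr_ge0.
suff -> : P = 0 by rewrite -B0 mulr0 expr0n.
rewrite /P big1// => i _; suff -> : b i = 0 by rewrite mulr0.
apply/eqP; rewrite -sqrf_eq0.
move/esym/eqP: B0; rewrite psumr_eq0; last by move=> j _; exact: sqr_ge0.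
by move/allP => /(_ i (mem_index_enum _)).
Qed.

Lemma edist_triangle y x z : edist x z <= edist x y + edist y z.
Proof.
rewrite -(@ler_pXn2r _ 2)// ?nnegrE ?addr_ge0 ?edist_ge0//.
have cs : \sum_i (x 0 i - y 0 i) * (y 0 i - z 0 i) <= edist x y * edist y z.
  apply: le_trans (ler_norm _) _.
  rewrite -(@ler_pXn2r _ 2)// ?nnegrE ?mulr_ge0 ?edist_ge0//.
  by rewrite real_normK ?num_real// exprMn !edist_sqr; exact: cauchy_schwarz.
rewrite sqrrD !edist_sqr.
have -> : \sum_i (x 0 i - z 0 i) ^+ 2 = \sum_i (x 0 i - y 0 i) ^+ 2
    + (\sum_i (x 0 i - y 0 i) * (y 0 i - z 0 i)) *+ 2
    + \sum_i (y 0 i - z 0 i) ^+ 2.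
  by rewrite -mulr_natl mulr_sumr -!big_split/=; apply: eq_bigr => i _; ring.
by rewrite lerD2r lerD2l lerMn2r.
Qed.

Lemma edist_le_sum x y : edist x y <= \sum_(i < d) `|x 0 i - y 0 i|.
Proof.
have sge0 (s : seq 'I_d) : 0 <= \sum_(i <- s) `|x 0 i - y 0 i|.
  exact: sumr_ge0.
rewrite -(@ler_pXn2r _ 2)// ?nnegrE ?edist_ge0// edist_sqr.
elim: (index_enum _) => [|i s ih]; first by rewrite !big_nil expr0n.
rewrite !big_cons [leRHS]sqrrD real_normK ?num_real// -addrA lerD2l.
by rewrite (le_trans ih)// lerDr mulrn_wge0// mulr_ge0.
Qed.

Lemma edistZB (a : R) x y z : edist (a *: (x - z)) (a *: (y - z)) = `|a| * edist x y.
Proof.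
rewrite /edist -sqrtr_sqr -sqrtrM ?sqr_ge0// mulr_sumr.
by congr Num.sqrt; apply: eq_bigr => i _; rewrite !mxE; ring.
Qed.

Let dot x y := \sum_i x 0 i * y 0 i.

(** Interiors of cells can only be located if a similarity, defined by
distances alone, maps balls onto balls.  Normalized to fix 0 and to preserve
distances, it preserves the dot product by polarization, so the images of the
basis vectors are the rows of an orthogonal matrix, by which it must act. *)
Lemma similarity_surj (Psi : 'rV[R]_d -> 'rV[R]_d) :
  is_similarity Psi -> forall y, exists x, Psi x = y.
Proof.
move=> [r r0 Psir] y.
pose g x := r^-1 *: (Psi x - Psi 0).
have gd u v : edist (g u) (g v) = edist u v.
  by rewrite edistZB Psir gtr0_norm ?invr_gt0// mulKf ?lt0r_neq0.
have dotE u v : dot u v =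
    (edist u 0 ^+ 2 + edist v 0 ^+ 2 - edist u v ^+ 2) / 2.
  rewrite !edist_sqr -big_split -sumrB/= mulr_suml; apply: eq_bigr => i _.
  by rewrite !mxE; field.
have g0 : g 0 = 0 by rewrite /g subrr scaler0.
have gdot u v : dot (g u) (g v) = dot u v.
  by rewrite !dotE -{1 2}g0 !gd.
pose A : 'M[R]_d := \matrix_i g (delta_mx 0 i).
have dotA u : g u *m A^T = u.
  apply/rowP => i; rewrite !mxE -[RHS](_ : dot u (delta_mx 0 i) = _).
    by rewrite -gdot; apply: eq_bigr => j _; rewrite !mxE.
  rewrite /dot (bigD1 i)//= big1 ?addr0; last first.
    by move=> j /negPf ji; rewrite mxE ji andbF mulr0.
  by rewrite mxE !eqxx mulr1.
have AA : A *m A^T = 1%:M.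
  apply/row_matrixP => i; rewrite row_mul rowK dotA row1.
  by [].
have := dotA (r^-1 *: (y - Psi 0) *m A^T).
move/(congr1 (mulmx^~ A)); rewrite -!mulmxA (mulmx1C AA) !mulmx1.
move/(scalerI (invr_neq0 (lt0r_neq0 r0)))/addIr => e.
by eexists; exact: e.
Qed.

End Euclid.

(** * Diameters, and packing of separated points *)

Section Diameter.
Context (R : realType) (d : nat).
Implicit Types (x y z : 'rV[R]_d) (A B : set 'rV[R]_d).

(** The topology is that of the max norm; the two distances differ by a factor
at most d. *)
Lemma nbhs_edist x A : nbhs x A <->
  exists2 e : R, 0 < e & forall y, edist x y < e -> A y.
Proof.
split.
  move/nbhs_ballP => [e /= e0 eA]; exists e => // y xy; apply: eA.
  split=> // i j; rewrite ord1 /ball/=.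
  by rewrite (le_lt_trans (edist_coord _ _ _)).
move=> [e e0 eA]; apply/nbhs_ballP; exists (e / d.+1%:R) => /=.
  by rewrite divr_gt0.
move=> y [_ xy]; apply: eA; rewrite (le_lt_trans (edist_le_sum _ _))//.
rewrite (@le_lt_trans _ _ (\sum_(i < d) e / d.+1%:R))//.
  by apply: ler_sum => i _; have /ltW := xy 0 i.
by rewrite sumr_const card_ord -mulrnAl -mulr_natr ltr_pdivrMr// ltr_pM2l// ltr_nat.
Qed.

Lemma compact_edist_bounded A : compact A ->
  exists M : R, forall x y, A x -> A y -> edist x y <= M.
Proof.
move/compact_bounded => [M [_ /(_ (M + 1))]].
rewrite ltrDl ltr01 => /(_ isT) AM.
have coord x i : A x -> `|x 0 i| <= M + 1.
  move/AM => /=; apply: le_trans; rewrite /Num.norm/= mx_normrE.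
  exact: (le_bigmax _ (fun ij => `|x ij.1 ij.2|) (0, i)).
exists (\sum_(i < d) (M + 1 + (M + 1))) => x y Ax Ay.
rewrite (le_trans (edist_le_sum _ _))//; apply: ler_sum => i _.
by rewrite (le_trans (ler_normB _ _))// lerD// coord.
Qed.

Local Open Scope ereal_scope.

Lemma diam_ge0 A : 0 <= diam A.
Proof. by apply: ereal_sup_ubound; left. Qed.

Lemma edist_le_diam A x y : A x -> A y -> (edist x y)%:E <= diam A.
Proof. by move=> Ax Ay; apply: ereal_sup_ubound; right; exists x => //; exists y. Qed.

Lemma diam_le A (M : \bar R) : 0 <= M ->
  (forall x y, A x -> A y -> (edist x y)%:E <= M) -> diam A <= M.
Proof.
move=> M0 AM; apply: ge_ereal_sup => _ [->//|[x Ax [y Ay <-]]].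
exact: AM.
Qed.

Lemma diam_fineP A (D : R) : diam A <= D%:E -> (fine (diam A))%:E = diam A.
Proof.
move=> AD; rewrite fineK// ge0_fin_numE ?diam_ge0//.
by rewrite (le_lt_trans AD)// ltry.
Qed.

Lemma diam_similarity (r D : R) (Psi : 'rV[R]_d -> 'rV[R]_d) A : (0 < r)%R ->
  (forall x y, edist (Psi x) (Psi y) = (r * edist x y)%R) ->
  diam A = D%:E -> diam (Psi @` A) = (r * D)%:E.
Proof.
move=> r0 Psir AD.
have AD' x y : A x -> A y -> (edist x y <= D)%R.
  by move=> Ax Ay; rewrite -lee_fin -AD edist_le_diam.
have D0 : (0 <= D)%R by rewrite -lee_fin -AD diam_ge0.
have le1 : diam (Psi @` A) <= (r * D)%:E.
  apply: diam_le => [|_ _ [x Ax <-] [y Ay <-]].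
    by rewrite lee_fin mulr_ge0// ltW.
  by rewrite Psir lee_fin ler_pM2l// AD'.
apply/eqP; rewrite eq_le le1/= -(diam_fineP le1) lee_fin mulrC.
rewrite -ler_pdivlMr// -lee_fin -AD; apply: diam_le.
  by rewrite lee_fin divr_ge0 ?(ltW r0)// fine_ge0 ?diam_ge0.
move=> x y Ax Ay; rewrite lee_fin ler_pdivlMr// mulrC -Psir.
rewrite -lee_fin (diam_fineP le1).
by apply: edist_le_diam; [exists x|exists y].
Qed.

(** In dimension 0 the ball is a point, whence the hypothesis on d. *)
Lemma diam_closed_ball x (r : R) : (0 < d)%N -> (0 <= r)%R ->
  diam [set y | (edist x y <= r)%R] = (2 * r)%:E.
Proof.
move=> d0 r0; apply/eqP; rewrite eq_le; apply/andP; split.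
  apply: diam_le => [|y z /= xy xz]; first by rewrite lee_fin mulr_ge0.
  rewrite lee_fin (le_trans (edist_triangle x _ _))// edistC.
  by rewrite mulr_natl mulr2n lerD.
pose e : 'rV[R]_d := (delta_mx 0 (Ordinal d0))%R.
have xD t : edist x (x + t *: e)%R = `|t|%R.
  rewrite /edist (bigD1 (Ordinal d0))//= big1 ?addr0; last first.
    move=> i /negPf i0.
    by rewrite !mxE i0 andbF mulr0 addr0 subrr expr0n.
  by rewrite !mxE !eqxx mulr1 opprD addNKr sqrrN sqrtr_sqr.
have -> : (2 * r)%R = edist (x + (- r) *: e)%R (x + r *: e)%R.
  rewrite /edist (bigD1 (Ordinal d0))//= big1 ?addr0; last first.
    move=> i /negPf i0.
    by rewrite !mxE i0 andbF !mulr0 subrr expr0n.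
  rewrite !mxE !eqxx !mulr1 -sqrrN sqrtr_sqr.
  rewrite [X in (`|X|)%R](_ : _ = 2 * r)%R; last by ring.
  by rewrite ger0_norm// mulr_ge0.
by apply: edist_le_diam; rewrite /= xD ?normrN ger0_norm.
Qed.

Lemma diam_compact A : compact A -> exists D : R, diam A = D%:E.
Proof.
move=> /compact_edist_bounded[M AM]; exists (fine (diam A)).
symmetry; apply: (@diam_fineP A (Num.max 0 M)%R); apply: diam_le.
  by rewrite lee_fin le_max lexx.
by move=> x y Ax Ay; rewrite lee_fin le_max AM ?orbT.
Qed.

Lemma diam_gt0 A : (0 < d)%N -> A° !=set0 -> 0 < diam A.
Proof.
move=> d0 [x /nbhs_edist[e e0 eA]].
have e20 : (0 < e / 2)%R by rewrite divr_gt0.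
have := @diam_closed_ball x (e / 2)%R d0 (ltW e20).
move=> h; apply: (@lt_le_trans _ _ (2 * (e / 2))%:E).
  by rewrite lte_fin mulr_gt0.
rewrite -h; apply: diam_le; first exact: diam_ge0.
move=> y z /= xy xz; apply: edist_le_diam; apply: eA.
  by rewrite (le_lt_trans xy)// ltr_pdivrMr// ltr_pMr// ltr1n.
by rewrite (le_lt_trans xz)// ltr_pdivrMr// ltr_pMr// ltr1n.
Qed.

End Diameter.

(** The map to the cells of a grid with mesh (eta/(d+1)) r is injective, as two
points in one cell are less than eta r apart; and both the mesh and the ball
scale with r, so that the number of cells depends on eta, t and d only. *)
Lemma packing (R : realType) (d : nat) (eta t : R) : 0 < eta ->
  exists N : nat, forall (r : R) (p : 'rV[R]_d) (T : eqType) (F : seq T)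
      (y : T -> 'rV[R]_d), 0 < r -> uniq F ->
    (forall u, u \in F -> edist p (y u) <= t * r) ->
    (forall u v, u \in F -> v \in F -> u != v -> eta * r <= edist (y u) (y v)) ->
    (size F <= N)%N.
Proof.
move=> eta0; pose h := eta / d.+1%:R.
have h0 : 0 < h by rewrite divr_gt0.
pose K := Num.truncn (2 * t / h).
exists #|{ffun 'I_d -> 'I_K.+1}| => r p T F y r0 Fu Fp Fsep.
pose z u (i : 'I_d) := (y u 0 i - p 0 i + t * r) / (h * r).
pose cell u : {ffun 'I_d -> 'I_K.+1} := [ffun i => inord (Num.truncn (z u i))].
have hr0 : 0 < h * r by rewrite mulr_gt0.
have z_itv u i : u \in F -> 0 <= z u i <= 2 * t / h.
  move/Fp => up; have := le_trans (edist_coord _ _ i) up.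
  rewrite distrC ler_norml => /andP[l1 l2]; apply/andP; split.
    by rewrite divr_ge0 ?(ltW hr0)// -lerBlDr sub0r.
  rewrite ler_pdivrMr// mulrA divfK ?lt0r_neq0//.
  by rewrite -mulrA mulr_natl mulr2n lerD2r.
have z_nat u i : u \in F -> (Num.truncn (z u i) <= K)%N.
  by move=> /z_itv-/(_ i)/andP[_]; exact: le_truncn.
have cell_inj : {in F &, injective cell}.
  move=> u v uF vF uv; apply/eqP; apply: contraT => uv_neq.
  have := Fsep _ _ uF vF uv_neq; rewrite leNgt => /negP[].
  rewrite (le_lt_trans (edist_le_sum _ _))//.
  rewrite (@le_lt_trans _ _ (\sum_(i < d) h * r))//; last first.
    rewrite sumr_const card_ord -mulrnAl ltr_pM2r//.
    by rewrite /h -mulrnAl -mulr_natr ltr_pdivrMr// ltr_pM2l// ltr_nat.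
  apply: ler_sum => i _.
  have : cell u i = cell v i by rewrite uv.
  rewrite !ffunE => /(congr1 val); rewrite /= !inordK ?ltnS ?z_nat// => e.
  have /andP[zu0 _] := z_itv u i uF; have /andP[zv0 _] := z_itv v i vF.
  have /andP[u1 u2] := truncn_itv zu0; have /andP[v1 v2] := truncn_itv zv0.
  rewrite -e -natr1 in v1 v2; rewrite -natr1 in u2.
  have -> : y u 0 i - y v 0 i = (z u i - z v i) * (h * r).
    by rewrite /z -mulrBl divfK ?lt0r_neq0//; ring.
  rewrite normrM (gtr0_norm hr0) ler_piMl ?(ltW hr0)//.
  by rewrite ler_norml; apply/andP; split; lra.
rewrite -(size_map cell) cardE; apply: uniq_leq_size => [|c _].
  by rewrite map_inj_in_uniq.
by rewrite mem_enum.
Qed.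

(** * Sums over countable sets *)

Section ExtendedSums.
Context (R : realType) (T : choiceType).
Implicit Types (A B : set T) (f : T -> \bar R).
Local Open Scope ereal_scope.

Lemma esum_subset A B f : A `<=` B -> (forall x, 0 <= f x) ->
  \esum_(x in A) f x <= \esum_(x in B) f x.
Proof.
move=> AB f0; rewrite (esum_mkcond A) (esum_mkcond B).
apply: le_esum => x _; case: ifPn => [xA|_]; last by case: ifP.
by rewrite ifT//; move: xA; rewrite !inE => /AB.
Qed.

Lemma term_le_esum A f x : A x -> (forall x, 0 <= f x) ->
  f x <= \esum_(y in A) f y.
Proof.
move=> Ax f0; rewrite -(esum_set1 (f0 x)).
by apply: esum_subset => // _ ->.
Qed.

Lemma esum_seq (F : seq T) f : uniq F -> (forall x, 0 <= f x) ->
  \esum_(x in [set` F]) f x = \sum_(x <- F) f x.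
Proof.
move=> uF f0; rewrite (fsbig_seq _ _ uF); apply: esum_fset.
  exact: finite_seq.
by move=> i _; exact: f0.
Qed.

(** Made disjoint by keeping each point only in the first set that has it. *)
Lemma esum_bigcup_le (I : set nat) (J : nat -> set T) f :
  (forall x, 0 <= f x) ->
  \esum_(x in \bigcup_(i in I) J i) f x <=
  \esum_(i in I) \esum_(x in J i) f x.
Proof.
move=> f0; pose J' i := if i \in I then J i else set0.
have -> : \bigcup_(i in I) J i = \bigcup_i seqDU J' i.
  rewrite -seqDU_bigcup_eq; apply/seteqP; split=> [x [i Ii Jx]|x [i _]].
    by exists i => //; rewrite /J' mem_set.
  by rewrite /J'; case: ifPn => //; rewrite inE => Ii Jx; exists i.
rewrite esum_bigcupT//.
rewrite [leRHS]esum_mkcond; apply: le_esum => i _.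
have := @subset_seqDU _ J' i; rewrite {2}/J'; case: ifPn => iI h.
  exact: esum_subset.
by move: h; rewrite subset0 => ->; rewrite esum_set0.
Qed.

Lemma esum_le_card (A : set T) (f : T -> R) (N : nat) (b : R) : (0 <= b)%R ->
  (forall F : seq T, uniq F -> {in F, forall x, A x} -> (size F <= N)%N) ->
  (forall x, A x -> (f x <= b)%R) ->
  \esum_(x in A) (f x)%:E <= (N%:R * b)%:E.
Proof.
move=> b0 AN fb; apply: ge_ereal_sup => _ [X [finX XA] <-].
have [s sX] := (finite_seqP X).1 finX.
have FA x : x \in undup s -> A x.
  by rewrite mem_undup => xs; apply: XA; rewrite sX.
have -> : X = [set` undup s].
  by rewrite sX; apply/seteqP; split=> x /=; rewrite mem_undup.
rewrite -(fsbig_seq _ _ (undup_uniq s)) sumEFin lee_fin.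
apply: (@le_trans _ _ (\sum_(x <- undup s) b)%R).
  by rewrite big_seq [leRHS]big_seq; apply: ler_sum => x /FA/fb.
rewrite big_const_seq iter_addr_0 count_predT -[leLHS]mulr_natl ler_wpM2r// ler_nat.
by apply: AN => //; exact: undup_uniq.
Qed.

End ExtendedSums.

(** * The tree of words *)

Section Words.
Context (n : nat -> nat).
Hypothesis n_gt0 : forall k, (0 < n k)%N.
Implicit Types (u v : seq nat) (w : nat -> nat) (C M : set (seq nat)).

Lemma is_word_nil : is_word n [::].
Proof. by []. Qed.

Lemma is_word_cat u v : is_word n (u ++ v) -> is_word n u.
Proof.
move=> uv i iu; have := uv i; rewrite size_cat nth_cat iu; apply.
by rewrite ltn_addr.
Qed.

Lemma is_word_take u k : is_word n u -> is_word n (take k u).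
Proof. by rewrite -{1}(cat_take_drop k u) => /is_word_cat. Qed.

Lemma is_word_rcons u i :
  is_word n (rcons u i) <-> is_word n u /\ (i < n (size u))%N.
Proof.
split=> [ui|[uw iu] j].
  split; first by apply: (@is_word_cat _ [:: i]); rewrite cats1.
  by have := ui (size u); rewrite size_rcons nth_rcons ltnn eqxx; apply.
rewrite size_rcons ltnS leq_eqVlt nth_rcons => /predU1P[->|ju].
  by rewrite ltnn eqxx.
by rewrite ju uw.
Qed.

Lemma is_word_mkseq w k : is_inf_word n w -> is_word n (mkseq w k).
Proof. by move=> ww i; rewrite size_mkseq => ik; rewrite nth_mkseq. Qed.

Lemma parent_rcons u i : parent (rcons u i) = u.
Proof. by rewrite /parent size_rcons -cats1 take_size_cat. Qed.

Lemma take_mkseq w j k : (j <= k)%N -> take j (mkseq w k) = mkseq w j.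
Proof. by move=> jk; rewrite -map_take take_iota (minn_idPl jk). Qed.

(** Padding with 0 extends a finite word. *)
Lemma is_inf_word_nth u : is_word n u -> is_inf_word n (nth 0%N u).
Proof.
move=> uw i; have [iu|ui] := ltnP i (size u); first exact: uw.
by rewrite nth_default.
Qed.

(** Cells of words that part at p lie in distinct children of the cell of p. *)
Lemma diverge u v : prefix u v \/ prefix v u \/
  exists p i j, [/\ i <> j, prefix (rcons p i) u & prefix (rcons p j) v].
Proof.
elim: u v => [|a u ih] [|b v]; [by left|by left|by right; left|].
have [->|/eqP ab] := eqVneq a b; last first.
  by right; right; exists [::], a, b; rewrite /= !eqxx !prefix0s.
rewrite /= !eqxx/=; have [|[|[p [i [j [ij pu pv]]]]]] := ih v; [by left|by right; left|].
by right; right; exists (b :: p), i, j; rewrite /= eqxx.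
Qed.

Definition bar C := forall w, is_inf_word n w -> exists k, C (mkseq w k).

(** The compactness of the space of infinite words, in inductive form: if P
failed at the root, it would fail along a branch chosen letter by letter, and
this branch meets C. *)
Lemma bar_induction C (P : seq nat -> Prop) : bar C ->
  (forall u, is_word n u -> C u -> P u) ->
  (forall u, is_word n u -> (forall i, (i < n (size u))%N -> P (rcons u i)) ->
     P u) ->
  P [::].
Proof.
move=> barC PC Pext; apply: contrapT => nP0.
have next u : exists i, is_word n u -> ~ P u ->
    (i < n (size u))%N /\ ~ P (rcons u i).
  apply: contrapT => /forallNP h; have /not_implyP[uw] := h 0%N.
  move/not_implyP => [nPu _]; apply: nPu; apply: Pext => // i iu.
  by apply: contrapT => nPui; apply: (h i).
have [f fP] := choice next.
pose v := fix v k := if k is k'.+1 then rcons (v k') (f (v k')) else [::].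
have vP k : [/\ size (v k) = k, is_word n (v k) & ~ P (v k)].
  elim: k => [|k [sk wk nPk]] //=; have [h1 h2] := fP _ wk nPk.
  by rewrite size_rcons sk; split=> //; apply/is_word_rcons.
pose w k := f (v k).
have vw k : v k = mkseq w k by elim: k => // k ih; rewrite mkseqS -ih.
have ww : is_inf_word n w.
  move=> k; have [sk wk nPk] := vP k.
  by have [] := fP _ wk nPk; rewrite sk.
have [k] := barC w ww; rewrite -vw => Ck.
by have [_ wk] := vP k; apply; exact: PC.
Qed.

Definition minimal_words C : set (seq nat) :=
  [set u | C u /\ forall j, (j < size u)%N -> ~ C (take j u)].

(** On every branch minimality keeps the first word of C and no other. *)
Lemma bar_cut_set C : C `<=` is_word n -> bar C -> cut_set n (minimal_words C).
Proof.
move=> Cw barC; split=> [u [/Cw]//|w ww].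
have ex : exists k, `[< C (mkseq w k) >].
  by have [k Ck] := barC w ww; exists k; apply/asboolP.
have [k /asboolP Ck kmin] := ex_minnP ex.
exists (mkseq w k); split.
  split; last by rewrite /inf_prefix size_mkseq.
  split=> // j; rewrite size_mkseq => jk; rewrite take_mkseq; last exact: ltnW.
  by move/asboolP/kmin; rewrite leqNgt jk.
move=> u [[Cu umin] uw]; rewrite [RHS]uw; congr mkseq.
apply/eqP; rewrite eqn_leq; apply/andP; split.
  by apply: kmin; apply/asboolP; rewrite -uw.
rewrite leqNgt; apply/negP => ku; apply: (umin k ku).
by rewrite uw take_mkseq// ltnW.
Qed.

Lemma cut_set_bar M : cut_set n M -> bar M.
Proof.
move=> [_ cM] w /cM[u [[Mu uw] _]]; exists (size u).
by rewrite /inf_prefix in uw; rewrite -uw.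
Qed.

Fixpoint words m : seq (seq nat) :=
  if m is m'.+1 then [seq rcons u i | u <- words m', i <- iota 0 (n m')]
  else [:: [::]].

Lemma mem_words m u : u \in words m <-> is_word n u /\ size u = m.
Proof.
elim: m u => [|m ih] u /=.
  rewrite inE; split=> [/eqP->//|[_ /size0nil ->]//].
split=> [/allpairsP[[v i]/= [/ih[vw <-]]]|].
  rewrite mem_iota add0n /= => iv ->.
  by rewrite size_rcons; split=> //; apply/is_word_rcons.
case/lastP: u => [|u i] [//]; rewrite size_rcons => /is_word_rcons[uw iu] [sm].
apply/allpairsP; exists (u, i); split=> //; first by apply/ih.
by rewrite mem_iota -sm.
Qed.

Lemma big_words (R : nmodType) m (f : seq nat -> R) :
  \sum_(u <- words m.+1) f u =
  \sum_(u <- words m) \sum_(i < n m) f (rcons u i).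
Proof.
rewrite /= big_allpairs_dep; apply: eq_bigr => u _.
by rewrite -(big_mkord xpredT (fun i => f (rcons u i))) /index_iota subn0.
Qed.

Lemma finite_words K (M : set (seq nat)) : M `<=` is_word n ->
  (forall u, M u -> (size u <= K)%N) -> finite_set M.
Proof.
move=> Mw MK.
pose s := flatten [seq words m | m <- iota 0 K.+1].
apply: (@sub_finite_set _ _ [set` s]); last exact: finite_seq.
move=> u Mu; apply/flattenP; exists (words (size u)).
  by apply/mapP; exists (size u) => //; rewrite mem_iota ltnS MK.
by apply/mem_words; split=> //; exact: Mw.
Qed.

(** If the mass of a word does not exceed that of its children, mass can only
gain on the way from the root to a set C that meets every branch.  C may be
infinite, so this proceeds by bar induction on the mass of C below u. *)
Lemma bar_mass (R : realType) (mu : seq nat -> R) C : (forall u, 0 <= mu u) ->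
  (forall u, is_word n u -> mu u <= \sum_(i < n (size u)) mu (rcons u i)) ->
  bar C -> ((mu [::])%:E <= \esum_(u in C) (mu u)%:E)%E.
Proof.
move=> mu0 mu_ext barC.
have mue0 u : (0 <= (mu u)%:E)%E by rewrite lee_fin.
suff : ((mu [::])%:E <= \esum_(v in C `&` [set v | prefix [::] v]) (mu v)%:E)%E.
  by move/le_trans; apply; apply: esum_subset => // u [].
apply: (@bar_induction C (fun u =>
  ((mu u)%:E <= \esum_(v in C `&` [set v | prefix u v]) (mu v)%:E)%E)) => //.
  move=> u uw Cu; apply: (term_le_esum _ mue0); split=> //=.
  exact: prefix_refl.
move=> u uw ih.
apply: (@le_trans _ _ (\sum_(i < n (size u)) (mu (rcons u i))%:E)%E).
  by rewrite sumEFin lee_fin mu_ext.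
apply: (@le_trans _ _ (\sum_(i < n (size u))
    \esum_(v in C `&` [set v | prefix (rcons u i) v]) (mu v)%:E)%E).
  by apply: lee_sum => i _; exact: ih.
under eq_bigr do rewrite esum_mkcondr.
rewrite -esum_sum; last by move=> i j _ _; case: ifP.
rewrite esum_mkcondr; apply: le_esum => v _.
have [/existsP[i iv]|/existsPn h] :=
  boolP [exists i : 'I_(n (size u)), prefix (rcons u i) v].
  rewrite (bigD1 i)//= big1 ?adde0.
    rewrite ifT ?inE//= ifT// inE/=.
    exact: (prefix_trans (prefix_rcons _ _) iv).
  move=> j /eqP ji; rewrite ifF//; apply/negP; rewrite inE/= => jv; apply: ji.
  have {}jv := prefixP jv; have {}iv := prefixP iv.
  case: iv jv => [s ->] [t]; rewrite !cat_rcons => /eqP.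
  by rewrite eqseq_cat// eqxx => /eqP[/val_inj].
rewrite big1; first by case: ifP.
by move=> i _; rewrite ifF//; apply/negP; rewrite inE; apply/negP.
Qed.

End Words.

(** * Sums of powers as functions of the exponent *)

Section PowerSums.
Context (R : realType) (T : eqType).
Implicit Types (F : seq T) (x : T -> R) (q s t : R).

(** The gain q^(t-s) makes the sums of a cover small once the exponent exceeds
the critical one. *)
Lemma powsum_le F x q s t : s <= t -> (forall u, u \in F -> 0 < x u <= q) ->
  \sum_(u <- F) x u `^ t <= q `^ (t - s) * \sum_(u <- F) x u `^ s.
Proof.
move=> st xq; rewrite mulr_sumr big_seq [leRHS]big_seq; apply: ler_sum => u uF.
have /andP[x0 xuq] := xq u uF.
rewrite -{1}(subrK s t) [x u `^ (_ + s)]powRD ?(gt_eqF x0) ?implybT//.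
rewrite ler_wpM2r ?powR_ge0// ge0_ler_powR ?subr_ge0 ?nnegrE ?(ltW x0)//.
exact: le_trans (ltW x0) xuq.
Qed.

Lemma powsum_root_le F x q s t : 0 < q < 1 ->
  (forall u, u \in F -> 0 < x u <= q) ->
  \sum_(u <- F) x u `^ s <= 1 -> \sum_(u <- F) x u `^ t = 1 -> t <= s.
Proof.
move=> /andP[q0 q1] xq ss tt; rewrite leNgt; apply/negP => st.
have := powsum_le (ltW st) xq; rewrite tt leNgt => /negP[].
have qts : q `^ (t - s) < 1.
  have := @gt0_ltr_powR R (t - s) _ q 1; rewrite powR1.
  by apply; rewrite ?subr_gt0// ?nnegrE// ltW.
by rewrite (le_lt_trans (ler_piMr (powR_ge0 _ _) ss)).
Qed.

(** The intermediate value theorem between the exponent 0, where the sum is the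
number of terms, and an exponent B for which that number times q^B is 1. *)
Lemma powsum_root F x q : F != [::] -> 0 < q < 1 ->
  (forall u, u \in F -> 0 < x u <= q) ->
  exists2 s, 0 <= s & \sum_(u <- F) x u `^ s = 1.
Proof.
move=> F0 /andP[q0 q1] xq.
have sF : 1 <= (size F)%:R :> R by rewrite ler1n lt0n size_eq0.
pose B := ln (size F)%:R / - ln q.
have lnq : ln q < 0 by rewrite ln_lt0// q0 q1.
have B0 : 0 <= B by rewrite divr_ge0 ?ln_ge0// oppr_ge0 ltW.
have qB : (size F)%:R * q `^ B = 1.
  have F1 : 0 < (size F)%:R :> R by rewrite (lt_le_trans ltr01).
  rewrite /powR gt_eqF//.
  have -> : B * ln q = - ln (size F)%:R.
    by rewrite /B invrN mulrN mulNr divfK// lt_eqF.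
  by rewrite expRN lnK ?posrE// mulfV// gt_eqF.
pose f s := \sum_(u <- F) x u `^ s.
have f0 : f 0 = (size F)%:R.
  rewrite /f (eq_bigr (fun=> 1)); last by move=> u _; rewrite powRr0.
  by rewrite big_const_seq iter_addr_0 count_predT.
have fB : f B <= 1.
  by have := powsum_le B0 xq; rewrite subr0 -/(f B) -/(f 0) f0 mulrC qB.
have fc : continuous f.
  rewrite /f; elim: (F) xq => [|u G ih] Gq.
    by under eq_fun do rewrite big_nil; exact: cst_continuous.
  under eq_fun do rewrite big_cons.
  have /andP[x0 _] : 0 < x u <= q by apply: Gq; rewrite mem_head.
  have xc : continuous (fun s => x u `^ s).
    rewrite [X in continuous X](_ : _ = expR \o *%R^~ (ln (x u))).
      by move=> s; apply: continuous_comp;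
        [exact: mulrr_continuous|exact: continuous_expR].
    by apply/funext => s; rewrite /powR gt_eqF.
  move=> s; apply: cvgD; first exact: xc.
  by apply: ih => v vG; apply: Gq; rewrite inE vG orbT.
have := @IVT _ f 0 B 1 B0 (continuous_subspaceT fc).
rewrite ge_min fB orbT le_max f0 sF /= => /(_ isT)[s].
by rewrite in_itv/= => /andP[s0 _] fs; exists s.
Qed.

End PowerSums.

(** * Levels of the tree *)

Section Levels.
Context (R : realType) (n : nat -> nat) (c : nat -> nat -> R) (q : R).
Hypothesis n_gt0 : forall k, (0 < n k)%N.
Hypothesis q01 : 0 < q < 1.
Hypothesis c_bd : forall k j, (j < n k)%N -> 0 < c k j <= q.
Implicit Types (u : seq nat) (s : R) (C : set (seq nat)).

Definition word_ratio u : R := \prod_(i < size u) c i (nth 0%N u i).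

Lemma word_ratio_nil : word_ratio [::] = 1.
Proof. by rewrite /word_ratio big_ord0. Qed.

Lemma word_ratio_rcons u i :
  word_ratio (rcons u i) = word_ratio u * c (size u) i.
Proof.
rewrite /word_ratio size_rcons big_ord_recr/= nth_rcons ltnn eqxx; congr (_ * _).
by apply: eq_bigr => j _; rewrite nth_rcons ltn_ord.
Qed.

Lemma word_ratio_bd u : is_word n u -> 0 < word_ratio u <= q ^+ size u.
Proof.
elim/last_ind: u => [|u i ih]; first by rewrite word_ratio_nil ltr01 expr0 lexx.
move=> /is_word_rcons[/ih/andP[u0 uq] /c_bd/andP[c0 cq]].
rewrite word_ratio_rcons size_rcons exprSr mulr_gt0//=.
by rewrite ler_pM// ltW.
Qed.

Lemma powsum_words m s : \sum_(u <- words n m) word_ratio u `^ s =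
  \prod_(i < m) \sum_(j < n i) c i j `^ s.
Proof.
elim: m => [|m ih]; first by rewrite big_seq1 word_ratio_nil powR1 big_ord0.
rewrite big_words big_ord_recr/= -ih mulr_suml big_seq [RHS]big_seq.
apply: eq_bigr => u /mem_words[uw um]; rewrite mulr_sumr; apply: eq_bigr => j _.
have /andP[u0 _] := word_ratio_bd uw.
rewrite word_ratio_rcons um powRM ?(ltW u0)//.
by have /andP[/ltW] := c_bd (ltn_ord j).
Qed.

Let words_bd m : (0 < m)%N ->
  forall u, u \in words n m -> 0 < word_ratio u <= q.
Proof.
move=> m0 u /mem_words[uw um]; have /andP[-> /le_trans] := word_ratio_bd uw.
apply; have /andP[q0 q1] := q01.
by rewrite um -(prednK m0) exprS ler_piMr ?exprn_ile1// ltW.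
Qed.

Lemma words_neq0 m : words n m != [::].
Proof.
suff : nseq m 0%N \in words n m by case: (words n m).
by apply/mem_words; rewrite size_nseq; split=> // i; rewrite nth_nseq if_same.
Qed.

Lemma s_levelP m : (0 < m)%N ->
  \sum_(u <- words n m) word_ratio u `^ s_level n c m = 1.
Proof.
move=> m0; have [s _ e] := powsum_root (words_neq0 m) q01 (words_bd m0).
rewrite powsum_words /s_level.
apply: (@xgetPex _ 0 [set s : R | \prod_(i < m) (\sum_(j < n i) c i j `^ s) = 1]).
by exists s; rewrite /= -powsum_words.
Qed.

Lemma s_level_le m s : (0 < m)%N ->
  \prod_(i < m) (\sum_(j < n i) c i j `^ s) <= 1 -> s_level n c m <= s.
Proof.
move=> m0; rewrite -powsum_words => ss.
exact: powsum_root_le q01 (words_bd m0) ss (s_levelP m0).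
Qed.

(** Dividing c_u^s by the sum P_k(s) over the level k of u gives a mass that is
conserved from a word to its children.  If P_k(s) > 1 at every level met by C,
the total mass of C would be less than that of the root. *)
Lemma bar_level C (b s : R) : 0 <= b -> C `<=` is_word n -> bar n C ->
  (\esum_(u in C) (b * word_ratio u `^ s)%:E < b%:E)%E ->
  exists2 u, C u & \prod_(i < size u) (\sum_(j < n i) c i j `^ s) <= 1.
Proof.
move=> b0 Cw barC; apply: contraPP => /forall2NP noC; apply/negP; rewrite -leNgt.
pose S i := \sum_(j < n i) c i j `^ s; pose P k := \prod_(i < k) S i.
have S0 i : 0 < S i.
  rewrite /S (bigD1 (Ordinal (n_gt0 i)))//= ltr_wpDr//.
    by apply: sumr_ge0 => j _; exact: powR_ge0.
  by rewrite powR_gt0//; have /andP[] := c_bd (n_gt0 i).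
have P0 k : 0 < P k by apply: prodr_gt0 => i _; exact: S0.
pose mu u := b * word_ratio u `^ s / P (size u).
have mu0 u : 0 <= mu u by rewrite divr_ge0 ?mulr_ge0 ?powR_ge0// ltW.
have mu_ext u : is_word n u -> mu u <= \sum_(i < n (size u)) mu (rcons u i).
  move=> uw; rewrite le_eqVlt; apply/orP; left; apply/eqP.
  have /andP[u0 _] := word_ratio_bd uw.
  transitivity (\sum_(i < n (size u)) mu u / S (size u) * c (size u) i `^ s).
    by rewrite -mulr_sumr divfK// gt_eqF// S0.
  apply: eq_bigr => i _; have /andP[c0 _] := c_bd (ltn_ord i).
  rewrite /mu word_ratio_rcons size_rcons powRM ?ltW// /P big_ord_recr/=.
  by rewrite invfM; ring.
have -> : (b%:E = (mu [::])%:E)%E.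
  by rewrite /mu word_ratio_nil powR1 /P big_ord0 divr1 mulr1.
apply: (le_trans (bar_mass mu0 mu_ext barC)).
apply: le_esum => u Cu; rewrite lee_fin /mu ler_pdivrMr// ler_peMr ?mulr_ge0 ?powR_ge0//.
have [//|/negP] := noC u.
by rewrite -ltNge => /ltW.
Qed.

End Levels.

(** * Geometry of the cells of a Moran set *)

Lemma exists_expr_le (R : realType) (q a e : R) : 0 < q < 1 -> 0 < a -> 0 < e ->
  exists k, q ^+ k * a <= e.
Proof.
move=> /andP[q0 q1] a0 e0.
have : q ^+ k @[k --> \oo] --> 0 by apply: cvg_expr; rewrite gtr0_norm.
move=> /cvgrPdist_le /(_ (e / a)); rewrite divr_gt0// => /(_ isT)[k _ kP].
exists k; have := kP k (leqnn k); rewrite /= sub0r normrN ger0_norm ?exprn_ge0 ?(ltW q0)//.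
by rewrite ler_pdivlMr.
Qed.

Section MoranGeometry.
Context (R : realType) (d : nat) (n : nat -> nat) (c : nat -> nat -> R)
  (J : set 'rV[R]_d) (Js : seq nat -> set 'rV[R]_d).
Hypothesis hM : moran_structure n c J Js.
Hypothesis hc : 0 < c_star n c.
Implicit Types (u v : seq nat) (w : nat -> nat) (F : seq (seq nat)).

Lemma moran_n_gt0 k : (0 < n k)%N.
Proof. exact: ltnW (moran_n_ge2 hM k). Qed.

Lemma c_star_le k j : (j < n k)%N -> c_star n c <= c k j.
Proof.
move=> jk; apply: ge_inf; last by exists k, j.
by exists 0 => _ [k' [j' [jk' ->]]]; rewrite ltW// (moran_c_gt0 hM).
Qed.

(** In dimension 0 the ratios would satisfy n_k <= 1. *)
Lemma moran_d_gt0 : (0 < d)%N.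
Proof.
rewrite lt0n; apply/negP => /eqP d0; have := moran_c_sum hM 0.
rewrite d0; under eq_bigr do rewrite expr0.
by rewrite sumr_const card_ord lern1 leqNgt (moran_n_ge2 hM).
Qed.

(** Each level has a second ratio, at least c_*, so c^d <= 1 - c_*^d; and
1 - c^d <= d (1 - c) for c <= 1. *)
Lemma moran_ratio_bd : exists2 q : R, 0 < q < 1 &
  forall k j, (j < n k)%N -> 0 < c k j <= q.
Proof.
have d0 := moran_d_gt0; have dR : 0 < d%:R :> R by rewrite ltr0n.
pose q := 1 - c_star n c ^+ d / d%:R.
have cq k j : (j < n k)%N -> 0 < c k j <= q.
  move=> jk; have cj0 := moran_c_gt0 hM jk; rewrite cj0/=.
  have [i ij] : exists i : 'I_(n k), i != Ordinal jk.
    have [j0|j0] := eqVneq j 0%N.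
      by exists (Ordinal (moran_n_ge2 hM k)); rewrite -val_eqE/= j0.
    by exists (Ordinal (moran_n_gt0 k)); rewrite -val_eqE/= eq_sym.
  have sum1 : c k j ^+ d + c_star n c ^+ d <= 1.
    apply: le_trans (moran_c_sum hM k).
    rewrite (bigD1 (Ordinal jk))//= lerD2l (bigD1 i)//=.
    rewrite (le_trans (_ : _ <= c k i ^+ d))//.
      by rewrite lerXn2r ?nnegrE ?(ltW hc)// ?c_star_le// ltW// (moran_c_gt0 hM).
    rewrite lerDl; apply: sumr_ge0 => l _.
    by rewrite exprn_ge0// ltW// (moran_c_gt0 hM).
  have c1 : c k j <= 1.
    rewrite -(@expr_le1 _ d) ?(ltW cj0)//; apply: le_trans sum1.
    by rewrite lerDl exprn_ge0// ltW.
  rewrite /q lerBrDl -lerBrDr ler_pdivrMr//.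
  have -> : c_star n c ^+ d <= (1 - c k j) * d%:R => //.
  apply: (@le_trans _ _ (1 - c k j ^+ d)); first by rewrite lerBrDl.
  rewrite -opprB subrX1 -mulNr opprB ler_wpM2l ?subr_ge0//.
  rewrite (le_trans (_ : _ <= \sum_(i < d) 1))//; last first.
    by rewrite sumr_const card_ord.
  by apply: ler_sum => l _; rewrite exprn_ile1// ltW.
exists q => //; apply/andP; split.
  by have /andP[/lt_le_trans h /h] := cq 0%N 0%N (moran_n_gt0 0).
by rewrite ltrBlDr ltrDl divr_gt0// exprn_gt0.
Qed.

Lemma c_star_lt1 : c_star n c < 1.
Proof.
have [q /andP[_ q1] cq] := moran_ratio_bd.
apply: le_lt_trans (c_star_le (moran_n_gt0 0)) _.
by apply: le_lt_trans q1; case/andP: (cq _ _ (moran_n_gt0 0)).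
Qed.

Definition cell_diam u : R := fine (diam (Js u)).
Let a := cell_diam.

Lemma cell_diamP u : is_word n u -> 0 < a u /\ diam (Js u) = (a u)%:E.
Proof.
move=> uw; have [Psi [r r0 Psir] JsE] := moran_similar hM uw.
have [D JD] := diam_compact (moran_J_compact hM).
have := diam_gt0 moran_d_gt0 (moran_J_interior hM); rewrite JD lte_fin => D0.
have e : diam (Js u) = (r * D)%:E by rewrite JsE; exact: diam_similarity.
by rewrite /a /cell_diam e /= mulr_gt0.
Qed.

Lemma cell_diam_gt0 u : is_word n u -> 0 < a u.
Proof. by case/cell_diamP. Qed.

Lemma diam_cell u : is_word n u -> diam (Js u) = (a u)%:E.
Proof. by case/cell_diamP. Qed.

Lemma cell_diam_rcons u i : is_word n u -> (i < n (size u))%N ->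
  a (rcons u i) = c (size u) i * a u.
Proof.
move=> uw iu; rewrite -(moran_ratio hM uw iu) -/(cell_diam u) divfK//.
by rewrite gt_eqF// cell_diam_gt0.
Qed.

Lemma cell_diamE u : is_word n u -> a u = word_ratio c u * a [::].
Proof.
elim/last_ind: u => [|u i ih]; first by rewrite word_ratio_nil mul1r.
move=> /is_word_rcons[uw iu]; rewrite cell_diam_rcons// ih// word_ratio_rcons.
by rewrite mulrA [c _ _ * _]mulrC.
Qed.

Lemma cell_prefix_sub u v : is_word n v -> prefix u v -> Js v `<=` Js u.
Proof.
move=> vw /prefixP[s vE]; subst v.
elim/last_ind: s vw => [|s i ih]; first by rewrite cats0 => _ x.
rewrite -rcons_cat => /is_word_rcons[uw iu].
by apply: (subset_trans (moran_sub hM uw iu)); exact: ih.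
Qed.

Lemma cell_diam_prefix u v : is_word n v -> prefix u v -> a v <= a u.
Proof.
move=> vw uv; have uw : is_word n u.
  by case/prefixP: uv => s vE; move: vw; rewrite vE => /is_word_cat.
rewrite -lee_fin -!diam_cell//; apply: diam_le => [|x y vx vy].
  exact: diam_ge0.
by apply: edist_le_diam; apply: cell_prefix_sub vx || apply: cell_prefix_sub vy.
Qed.

Lemma cell_diam_parent u : is_word n u -> c_star n c * a (parent u) <= a u.
Proof.
case/lastP: u => [|u i] uw.
  by rewrite /parent /= ler_piMl ?ltW ?c_star_lt1 ?cell_diam_gt0.
have /is_word_rcons[uw' iu] := uw; rewrite parent_rcons cell_diam_rcons//.
by rewrite ler_wpM2r ?c_star_le// ltW// cell_diam_gt0.
Qed.

Lemma cell_neq0 u : is_word n u -> Js u !=set0.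
Proof.
move=> uw; have [Psi _ ->] := moran_similar hM uw.
by have [x /interior_subset Jx] := moran_J_interior hM; exists (Psi x), x.
Qed.

(** A cluster point, in the compact J, of points chosen in the nested cells. *)
Lemma inf_word_point w : is_inf_word n w ->
  exists x, forall k, Js (mkseq w k) x.
Proof.
move=> ww; have wk k : is_word n (mkseq w k) by exact: is_word_mkseq.
have [x xP] := choice (fun k => cell_neq0 (wk k)).
have JxP k l : (k <= l)%N -> Js (mkseq w k) (x l).
  move=> kl; apply: cell_prefix_sub (xP l) => //.
  by rewrite -(take_mkseq w kl) prefix_take.
have xJ : (x @ \oo) J.
  exists 0%N => // k _ /=; rewrite -(moran_root hM).
  exact: (JxP 0%N k (leq0n k)).
have [p [_ pP]] := moran_J_compact hM (F := x @ \oo) _ xJ.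
exists p => k; have [+ _] := moran_closed hM (wk k); apply => B pB.
by apply: pP pB; exists k => // l /= kl; exact: JxP.
Qed.

(** A ball inside J is carried by the similarities to balls of proportional
size, centred at points of the cells. *)
Lemma inner_ball : exists2 rho : R, 0 < rho & forall u, is_word n u ->
  exists y, forall z, edist y z < rho * a u -> (Js u)° z.
Proof.
have [x0 /nbhs_edist[e e0 eJ]] := moran_J_interior hM.
have [D JD] := diam_compact (moran_J_compact hM).
have := diam_gt0 moran_d_gt0 (moran_J_interior hM); rewrite JD lte_fin => D0.
exists (e / D); first by rewrite divr_gt0.
move=> u uw; have [Psi Psis JsE] := moran_similar hM uw.
have Psi_surj := similarity_surj Psis; case: Psis => r r0 Psir.
have aE : e / D * a u = r * e.
  rewrite /a /cell_diam JsE (diam_similarity r0 Psir JD) /=.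
  by field; rewrite gt_eqF.
exists (Psi x0) => z; rewrite aE => zlt.
apply/nbhs_edist; exists (r * e - edist (Psi x0) z); first by rewrite subr_gt0.
move=> z'; rewrite ltrBrDl => /(le_lt_trans (edist_triangle _ _ _)).
have [t <-] := Psi_surj z'; rewrite Psir ltr_pM2l// => /eJ Jt.
by rewrite JsE; exists t.
Qed.

Lemma interior_cell_disjoint u v z : is_word n u -> is_word n v ->
  ~~ prefix u v -> ~~ prefix v u -> (Js u)° z -> (Js v)° z -> False.
Proof.
move=> uw vw; have [->//|[->//|[p [i [j [ij pu pv]]]]]] := diverge u v.
move=> _ _ uz vz.
have pw k x : is_word n x -> prefix (rcons p k) x ->
    is_word n p /\ (k < n (size p))%N.
  by move=> xw /prefixP[s xE]; apply/is_word_rcons; apply: (@is_word_cat _ _ s);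
     rewrite -xE.
have [pp ip] := pw _ _ uw pu; have [_ jp] := pw _ _ vw pv.
apply: ij; apply: (moran_disjoint hM pp) => //; exists z; split.
  by apply: interiorS uz; exact: cell_prefix_sub.
by apply: interiorS vz; exact: cell_prefix_sub.
Qed.

(** A proper prefix of v is a prefix of the parent of v, whose cell is already
larger than r. *)
Lemma first_small_incomparable (r : R) u v : is_word n u -> is_word n v ->
  a u <= r < a (parent u) -> a v <= r < a (parent v) -> u != v -> ~~ prefix u v.
Proof.
move=> uw vw /andP[ur _] /andP[_ rv] uv; apply/negP => /prefixP[s].
case/lastP: s => [|s i] vE; first by rewrite vE cats0 eqxx in uv.
move: vw rv; rewrite vE -rcons_cat => /is_word_rcons[w' _].
rewrite parent_rcons ltNge (le_trans _ ur)//.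
by apply: cell_diam_prefix => //; exact: prefix_prefix.
Qed.

(** The cells have disjoint interiors and contain balls of radius at least
rho c_* r, so their centres are rho c_* r apart, while all centres are within
2 r of a point of U. *)
Lemma few_cells : exists N : nat, forall (r : R) (U : set 'rV[R]_d) F,
  0 < r -> (diam U <= r%:E)%E -> uniq F ->
  (forall u, u \in F ->
    [/\ is_word n u, a u <= r < a (parent u) & Js u `&` U !=set0]) ->
  (size F <= N)%N.
Proof.
have [rho rho0 ballP] := inner_ball.
have [N NP] := @packing R d (rho * c_star n c) 2 (mulr_gt0 rho0 hc).
exists N => r U [//|u0 F0] r0 Ur; set F := u0 :: F0 => Fu FP.
have [_ _ [p [_ Up]]] := FP u0 (mem_head _ _).
have center u : exists y, is_word n u ->
    forall z, edist y z < rho * a u -> (Js u)° z.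
  have [uw|uw] := pselect (is_word n u); last by exists 0.
  by have [y] := ballP u uw; exists y.
have [y yP] := choice center.
have yy u : is_word n u -> (Js u)° (y u).
  by move=> uw; apply: yP => //; rewrite edistxx mulr_gt0// cell_diam_gt0.
apply: (NP r p _ F y) => // [u /FP[uw /andP[ur _] [z [uz Uz]]]|u v uF vF uv].
  rewrite (le_trans (edist_triangle z _ _))// mulr_natl mulr2n lerD//.
    by rewrite -lee_fin (le_trans _ Ur)// edist_le_diam.
  apply: le_trans ur; rewrite -lee_fin -diam_cell// edist_le_diam//.
  exact: interior_subset (yy u uw).
have [uw ur _] := FP u uF; have [vw vr _] := FP v vF.
have cr : c_star n c * r <= a u.
  apply: le_trans (cell_diam_parent uw); rewrite ler_wpM2l ?(ltW hc)//.
  by have /andP[_ /ltW] := ur.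
rewrite leNgt; apply/negP => lt.
apply: (@interior_cell_disjoint u v (y v)) => //; last exact: yy.
- exact: first_small_incomparable ur vr uv.
- by apply: first_small_incomparable vr ur _ => //; rewrite eq_sym.
- apply: yP => //; apply: (lt_le_trans lt).
  by rewrite -mulrA ler_pM2l.
Qed.

End MoranGeometry.

(** * From covers to words *)

Lemma finite_min (R : realType) (A : set R) : finite_set A -> A !=set0 ->
  exists2 m, A m & forall t, A t -> m <= t.
Proof.
move=> /finite_seqP[s ->{A}]; elim: s => [[x //]|x [|y s] ih _].
  by exists x; rewrite /= ?mem_head// => t; rewrite /= inE => /eqP->.
have [|m ms mP] := ih; first by exists y; rewrite /= mem_head.
exists (Num.min x m).
  by rewrite /= minEle; case: ifP => _; rewrite ?mem_head// inE ms orbT.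
move=> t; rewrite /= inE ge_min => /predU1P[->|/mP->]; first by rewrite lexx.
by rewrite orbT.
Qed.

Lemma has_cover_seq (R : realType) (d : nat) (E : set 'rV[R]_d)
    (theta s eps delta : R) (T : eqType) (F : seq T) (V : T -> set 'rV[R]_d)
    (b : T -> R) :
  (forall x, E x -> exists2 u, u \in F & V u x) ->
  (forall u, u \in F ->
     diam (V u) = (b u)%:E /\ scale_root delta theta <= b u <= delta) ->
  \sum_(u <- F) b u `^ s <= eps -> has_cover E theta s eps delta.
Proof.
move=> EV bV sumb; pose I := [set` iota 0 (size F)].
have IP i : I i -> (i < size F)%N by rewrite /I /= mem_iota.
exists I, (nth set0 (map V F)); split.
- move=> x /EV[u uF Vux]; have iu : (index u F < size F)%N by rewrite index_mem.
  exists (index u F); first by rewrite /I /= mem_iota.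
  by rewrite (nth_map u)// nth_index.
- move=> i /IP iF; case: F {I IP EV sumb} bV iF => // u0 F bV iF.
  rewrite (nth_map u0)//; have [-> /andP[h1 h2]] := bV _ (mem_nth u0 iF).
  by rewrite !lee_fin h1.
- rewrite esum_seq ?iota_uniq// => [|i]; last exact: poweR_ge0.
  rewrite -(big_map (nth set0 (map V F)) xpredT (fun A => (diam A `^ s)%E)).
  rewrite -(size_map V F) -/(mkseq _ _) mkseq_nth big_map big_seq.
  rewrite (eq_bigr (fun u => (b u `^ s)%:E)) => [|u /bV[-> _]].
    by rewrite -big_seq sumEFin lee_fin.
  exact: poweR_EFin.
Qed.

Section MoranDimension.
Context (R : realType) (d : nat) (n : nat -> nat) (c : nat -> nat -> R)
  (J : set 'rV[R]_d) (Js : seq nat -> set 'rV[R]_d).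
Hypothesis hM : moran_structure n c J Js.
Hypothesis hc : 0 < c_star n c.
Implicit Types (u v : seq nat) (w : nat -> nat) (F : seq (seq nat)).
Implicit Types (theta s t eps delta : R) (C M : set (seq nat)).

Let a : seq nat -> R := cell_diam Js.
Let E := moran_set n Js.

Let a0 : 0 < a [::] := cell_diam_gt0 hM (@is_word_nil n).

Lemma cell_diam_small (e : R) : 0 < e ->
  exists K, forall u, is_word n u -> (K <= size u)%N -> a u <= e.
Proof.
have [q q01 cq] := moran_ratio_bd hM hc; have /andP[q0 q1] := q01.
move=> e0; have [K KP] := exists_expr_le q01 a0 e0.
exists K => u uw Ku; apply: le_trans KP; rewrite /a (cell_diamE hM)//.
rewrite ler_wpM2r ?(ltW a0)//; have /andP[_ /le_trans] := word_ratio_bd cq uw; apply.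
by rewrite ler_wiXn2l// ltW.
Qed.

Lemma first_below_bar (r : R) : 0 < r < a [::] ->
  bar n [set u | is_word n u /\ a u <= r < a (parent u)].
Proof.
move=> /andP[r0 ra] w ww; have [K KP] := cell_diam_small r0.
have wk k : is_word n (mkseq w k) by exact: is_word_mkseq.
have ex : exists k, a (mkseq w k) <= r.
  by exists K; apply: KP => //; rewrite size_mkseq.
have [k kr kmin] := ex_minnP ex.
exists k; split=> //; rewrite kr /=; case: k kr kmin => [|k] kr kmin.
  by move: kr; rewrite leNgt ra.
by rewrite mkseqS parent_rcons ltNge; apply/negP => /kmin; rewrite ltnn.
Qed.

(** The passage from a cover to words.  N is the bound of [few_cells], hence the
same for all scales and exponents; the second eps pays for the sets of
diameter 0. *)
Lemma cover_bar : exists N : nat, forall theta s eps delta,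
  0 < s -> 0 < eps -> 0 < delta < a [::] -> has_cover E theta s eps delta ->
  exists C, [/\ C `<=` is_word n, bar n C,
    forall u, C u -> scale_root delta theta < a (parent u) /\ a u <= delta &
    (\esum_(u in C) (a u `^ s)%:E <= (N%:R * (eps + eps))%:E)%E].
Proof.
have [N NP] := few_cells hM hc.
exists N => theta s eps delta s0 eps0 /andP[delta0 deltaJ] [I [U [EU Ud Us]]].
pose e i : R := eps / (2 ^ i.+1)%:R.
have e0 i : 0 < e i by rewrite divr_gt0// ltr0n expn_gt0.
pose dU i := fine (diam (U i)).
have dUE i : I i -> diam (U i) = (dU i)%:E.
  by move=> /Ud/andP[_ /diam_fineP <-].
have dU0 i : 0 <= dU i by rewrite fine_ge0// diam_ge0.
(* A set of diameter 0 meets cells of no definite size, so each diameter is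
   raised to a positive radius at a total cost of at most eps. *)
pose r i := Num.max (dU i) (Num.min delta (e i `^ s^-1)).
have r0 i : 0 < r i by rewrite lt_max lt_min delta0 powR_gt0 ?orbT.
have r_delta i : I i -> r i <= delta.
  move=> Ii; rewrite ge_max ge_min lexx/= andbT -lee_fin -dUE//.
  by case/andP: (Ud _ Ii).
have rs i : r i `^ s <= dU i `^ s + e i.
  rewrite /r maxEle; case: ifPn => _; last by rewrite lerDl ltW.
  apply: (@le_trans _ _ (e i)); last by rewrite lerDr powR_ge0.
  apply: (@le_trans _ _ ((e i `^ s^-1) `^ s)).
    by apply: ge0_ler_powR; rewrite ?nnegrE ?(ltW s0) ?powR_ge0// ?ge_min ?lexx
       ?orbT// le_min powR_ge0 ltW.
  by rewrite -powRrM mulVf ?gt_eqF// powRr1// ltW.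
pose Ci i := [set u | [/\ is_word n u, a u <= r i < a (parent u)
                        & Js u `&` U i !=set0]].
exists (\bigcup_(i in I) Ci i); split.
- by move=> u [i _ []].
- move=> w ww; have [x xP] := inf_word_point hM ww.
  have Ex : E x.
    move=> k _; exists (mkseq w k) => //; split; last by rewrite size_mkseq.
    exact: is_word_mkseq.
  have [i Ii Uix] := EU _ Ex.
  have ri : 0 < r i < a [::] by rewrite r0 (le_lt_trans (r_delta i Ii)).
  have [k [wk kr]] := first_below_bar ri ww.
  by exists k, i => //; split=> //; exists x.
- move=> u [i Ii [uw /andP[ur rp] _]]; split; last exact: le_trans ur (r_delta _ Ii).
  apply: le_lt_trans rp; rewrite le_max; apply/orP; left.
  by rewrite -lee_fin -dUE//; case/andP: (Ud _ Ii).
- apply: (le_trans (esum_bigcup_le _ _ _)).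
    by move=> u; rewrite lee_fin powR_ge0.
  apply: (@le_trans _ _ (\esum_(i in I) \sum_(j < N) (dU i `^ s + e i)%:E)%E).
    apply: le_esum => i Ii.
    apply: (le_trans (@esum_le_card _ _ _ _ N (dU i `^ s + e i) _ _ _)) => //.
    + by rewrite addr_ge0 ?powR_ge0// ltW.
    + move=> F uF FC; apply: (NP (r i) (U i) F) => //.
      by rewrite dUE// lee_fin le_max lexx.
    + move=> u [uw /andP[ur _] _]; apply: le_trans (rs i).
      by rewrite ge0_ler_powR ?nnegrE ?(ltW s0)// ltW// (cell_diam_gt0 hM).
    + by rewrite sumEFin lee_fin sumr_const card_ord mulr_natl.
  rewrite esum_sum; last first.
    by move=> i j _ _; rewrite lee_fin addr_ge0 ?powR_ge0// ltW.
  apply: (@le_trans _ _ (\sum_(j < N) (eps + eps)%:E)%E); last first.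
    by rewrite sumEFin lee_fin sumr_const card_ord mulr_natl.
  apply: lee_sum => _ _.
  under eq_esum do rewrite EFinD.
  rewrite esumD; last 2 first.
  - by move=> i _; rewrite lee_fin powR_ge0.
  - by move=> i _; rewrite lee_fin ltW.
  rewrite EFinD leeD//.
    apply: le_trans Us; apply: le_esum => i Ii.
    by rewrite dUE// poweR_EFin.
  apply: (@le_trans _ _ (\esum_(i in setT) (e i)%:E)%E).
    by apply: esum_subset => // i; rewrite lee_fin ltW.
  rewrite -nneseries_esumT; first exact: epsilon_trick0 (ltW eps0).
  by move=> i; rewrite lee_fin ltW.
Qed.

End MoranDimension.

(** * Cut sets and the exponents they define *)

Section MoranCuts.
Context (R : realType) (d : nat) (n : nat -> nat) (c : nat -> nat -> R)
  (J : set 'rV[R]_d) (Js : seq nat -> set 'rV[R]_d).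
Hypothesis hM : moran_structure n c J Js.
Hypothesis hc : 0 < c_star n c.
Implicit Types (u v : seq nat) (w : nat -> nat) (F : seq (seq nat)).
Implicit Types (theta s t eps delta : R) (C M : set (seq nat)).

Let a : seq nat -> R := cell_diam Js.
Let E := moran_set n Js.
Let a0 : 0 < a [::] := cell_diam_gt0 hM (@is_word_nil n).

Lemma is_word_parent u : is_word n u -> is_word n (parent u).
Proof. exact: is_word_take. Qed.

(** For theta > 0 the cells of the parents are bounded below in size, so that
only finitely many words, hence finitely many cut sets, are admissible. *)
Lemma admissible_cut_size theta delta : 0 < theta -> 0 < delta ->
  exists K, forall M, admissible_cut n Js delta theta M ->
    forall u, M u -> (size u <= K)%N.
Proof.
move=> th0 delta0.
have [|K KP] := cell_diam_small hM hc (e := scale_root delta theta).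
  by rewrite /scale_root gt_eqF// powR_gt0.
exists K => M [[Mw _] adM] u Mu; rewrite leqNgt; apply/negP => Ku.
have [pu _] := adM u Mu; have uw := Mw u Mu; have pw := is_word_parent uw.
move: pu; rewrite (diam_cell hM pw) lte_fin ltNge => /negP; apply.
apply: KP => //; rewrite /parent size_take.
by case: ifP => _; [rewrite -ltnS prednK// (leq_trans _ Ku)|exact: ltnW].
Qed.

Lemma esum_cells F s : uniq F -> (forall u, u \in F -> is_word n u) ->
  (\esum_(u in [set` F]) (diam (Js u) `^ s) = (\sum_(u <- F) a u `^ s)%:E)%E.
Proof.
move=> uF Fw; rewrite esum_seq//; last by move=> u; exact: poweR_ge0.
rewrite big_seq (eq_bigr (fun u => (a u `^ s)%:E)); last first.
  by move=> u /Fw uw; rewrite (diam_cell hM uw) poweR_EFin.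
by rewrite -big_seq sumEFin.
Qed.

Lemma cut_set_neq0 F : cut_set n [set` F] -> F != [::].
Proof.
move=> /cut_set_bar/(_ (fun=> 0%N)) [k|k /=]; first exact: moran_n_gt0 hM k.
by case: F.
Qed.

Lemma admissible_cut_seq theta delta M : 0 < theta -> 0 < delta ->
  admissible_cut n Js delta theta M ->
  exists F, [/\ uniq F, M = [set` F], F != [::],
    forall u, u \in F -> is_word n u &
    forall u, u \in F -> 0 < a u <= delta].
Proof.
move=> th0 delta0 adM; have [K KP] := admissible_cut_size th0 delta0.
have := adM; move=> [[Mw cM] uM].
have /finite_seqP[s sM] := finite_words Mw (KP _ adM).
have ME : M = [set` undup s].
  by rewrite sM; apply/seteqP; split=> u /=; rewrite mem_undup.
have FM u : u \in undup s -> M u by move=> us; rewrite ME.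
exists (undup s); split=> //; first exact: undup_uniq.
- by apply: cut_set_neq0; rewrite -ME.
- by move=> u /FM/Mw.
- move=> u /FM Mu; have uw := Mw u Mu; have [_] := uM u Mu.
  by rewrite (diam_cell hM uw) lee_fin /a (cell_diam_gt0 hM uw).
Qed.

Lemma bar_admissible theta delta C : C `<=` is_word n -> bar n C ->
  (forall u, C u -> scale_root delta theta < a (parent u) /\ a u <= delta) ->
  admissible_cut n Js delta theta (minimal_words C).
Proof.
move=> Cw barC CP; split; first exact: bar_cut_set.
move=> u [Cu _]; have uw := Cw _ Cu; have [h1 h2] := CP u Cu.
by rewrite (diam_cell hM uw) (diam_cell hM (is_word_parent uw)) lte_fin lee_fin.
Qed.

Lemma scale_root_le theta delta : 0 <= theta <= 1 -> 0 < delta <= 1 ->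
  scale_root delta theta <= delta.
Proof.
move=> /andP[th0 th1] /andP[d0 d1]; rewrite /scale_root; case: eqP => [_|/eqP thN].
  exact: ltW.
have {}th0 : 0 < theta by rewrite lt_def thN.
by rewrite -[leRHS]powRr1 ?(ltW d0)// ger_powR ?d0// invf_ge1.
Qed.

Lemma admissible_cut_exists theta delta : 0 <= theta <= 1 ->
  0 < delta <= 1 -> delta < a [::] ->
  exists M, admissible_cut n Js delta theta M.
Proof.
move=> th01 d01 da; have /andP[d0 _] := d01.
eexists; apply: (@bar_admissible _ _ [set u | is_word n u /\ a u <= delta < a (parent u)]).
- by move=> u [].
- by apply: (first_below_bar hM hc); rewrite d0.
- move=> u [_ /andP[h1 h2]]; split=> //.
  exact: le_lt_trans (scale_root_le th01 d01) h2.
Qed.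

(** The minimum defining s_(delta,theta) is attained: each admissible cut set
is finite and contributes exactly one exponent, and there are finitely many
such cut sets, being subfamilies of the words of bounded length. *)
Lemma s_deltaP theta delta : 0 < theta <= 1 -> 0 < delta < 1 ->
  delta < a [::] ->
  [/\ exists2 M, admissible_cut n Js delta theta M &
        (\esum_(u in M) (diam (Js u) `^ s_delta n Js theta delta) = 1)%E,
      forall M s, admissible_cut n Js delta theta M ->
        (\esum_(u in M) (diam (Js u) `^ s) = 1)%E ->
        s_delta n Js theta delta <= s &
      0 <= s_delta n Js theta delta].
Proof.
move=> /andP[th0 th1] /andP[d0 d1] da.
pose A := [set s : R | exists M, admissible_cut n Js delta theta M /\
                         (\esum_(u in M) (diam (Js u) `^ s) = 1)%E].
have d01 : 0 < delta < 1 by rewrite d0.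
have solve M : admissible_cut n Js delta theta M -> exists s,
    [/\ 0 <= s, (\esum_(u in M) (diam (Js u) `^ s) = 1)%E &
      forall t, (\esum_(u in M) (diam (Js u) `^ t) = 1)%E -> t = s].
  move=> adM; have [F [uF ME F0 Fw Fd]] := admissible_cut_seq th0 d0 adM.
  have [s s0 sF] := powsum_root F0 d01 Fd.
  exists s; rewrite ME esum_cells// sF; split=> // t.
  rewrite esum_cells// => -[tF]; apply/eqP; rewrite eq_le; apply/andP; split.
    by apply: powsum_root_le d01 Fd _ tF; rewrite sF.
  by apply: powsum_root_le d01 Fd _ sF; rewrite tF.
have A0 : A !=set0.
  have [||M adM] := @admissible_cut_exists theta delta _ _ da; rewrite ?d0 ?th1 ?ltW//.
  by have [s [_ sM _]] := solve M adM; exists s, M.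
have finA : finite_set A.
  have [K KP] := admissible_cut_size th0 d0.
  pose W := flatten [seq words n m | m <- iota 0 K.+1].
  pose g (m : (size W).-tuple bool) : R :=
    xget 0 [set s | (\esum_(u in [set` mask m W]) (diam (Js u) `^ s) = 1)%E].
  apply: (@sub_finite_set _ _ (range g)); last exact: finite_image finite_finset.
  move=> s [M [adM sM]].
  have MW u : M u -> u \in W.
    move=> Mu; apply/flattenP; exists (words n (size u)).
      by apply/mapP; exists (size u) => //; rewrite mem_iota ltnS (KP _ adM).
    by apply/mem_words; split=> //; case: adM => -[+ _] _; apply.
  exists [tuple of map (fun u => `[< M u >]) (in_tuple W)] => //.
  rewrite /g /= -filter_mask.
  have -> : [set` [seq u <- W | `[< M u >]]] = M.
    apply/seteqP; split=> u.
      by move=> h; have := mem_filter (fun u => `[< M u >]) u W;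
         rewrite h => /esym/andP[/asboolP].
    move=> Mu; have := mem_filter (fun u => `[< M u >]) u W.
    by rewrite MW// andbT (asboolT Mu).
  have [s' [_ _ s'P]] := solve M adM.
  rewrite (s'P s sM); apply: s'P.
  apply: (@xgetPex _ 0 [set s | (\esum_(u in M) (diam (Js u) `^ s) = 1)%E]).
  by exists s.
have [m Am mP] := finite_min finA A0.
have [[M [adM sM]] minA] : [set s | A s /\ forall t, A t -> s <= t] (s_delta n Js theta delta).
  by apply: xgetPex; exists m.
split; first by exists M.
- by move=> M' s adM' sM'; apply: minA; exists M'.
- by have [s [s0 _ sP]] := solve M adM; rewrite (sP _ sM).
Qed.

Lemma bar_s_delta theta delta s C : 0 < theta <= 1 -> 0 < delta < 1 ->
  delta < a [::] -> C `<=` is_word n -> bar n C ->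
  (forall u, C u -> scale_root delta theta < a (parent u) /\ a u <= delta) ->
  (\esum_(u in C) (a u `^ s)%:E <= 1)%E -> s_delta n Js theta delta <= s.
Proof.
move=> th01 d01 da Cw barC CP sC; have [_ sP _] := s_deltaP th01 d01 da.
have adM := bar_admissible Cw barC CP.
have /andP[th0 _] := th01; have /andP[d0 _] := d01.
have [F [uF ME F0 Fw Fd]] := admissible_cut_seq th0 d0 adM.
have [t t0 tF] := powsum_root F0 d01 Fd.
apply: (@le_trans _ _ t); first by apply: (sP _ _ adM); rewrite ME esum_cells// tF.
apply: powsum_root_le d01 Fd _ tF; rewrite -lee_fin; apply: le_trans sC.
rewrite -sumEFin -esum_seq//; last by move=> u; rewrite lee_fin powR_ge0.
rewrite -ME; apply: esum_subset; first by move=> u [].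
by move=> u; rewrite lee_fin powR_ge0.
Qed.

(** Every set, even of diameter 0, contributes 1 to the sum with exponent 0, so
the cover would be empty. *)
Lemma no_cover_exponent0 theta eps delta : eps < 1 ->
  has_cover E theta 0 eps delta -> False.
Proof.
move=> eps1 [I [U [EU Ud Us]]].
have [|x xP] := @inf_word_point _ _ _ _ _ _ hM (fun=> 0%N).
  by move=> k; exact: moran_n_gt0 hM k.
have [|i Ii _] := EU x.
  move=> k _; exists (mkseq (fun=> 0%N) k) => //; split; last by rewrite size_mkseq.
  by apply: is_word_mkseq => l; exact: moran_n_gt0 hM l.
move: Us; rewrite leNgt => /negP; apply.
apply: (@lt_le_trans _ _ 1%E); first by rewrite lte_fin.
have := @term_le_esum R _ I (fun i => diam (U i) `^ 0)%E i Ii.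
by rewrite poweRe0; apply => j; exact: poweR_ge0.
Qed.

Lemma cover_s_delta s : 0 <= s -> exists2 eps, 0 < eps &
  exists2 Delta, 0 < Delta & forall theta delta, 0 < theta <= 1 ->
  0 < delta < Delta -> has_cover E theta s eps delta ->
  s_delta n Js theta delta <= s.
Proof.
have [N NP] := cover_bar hM hc; rewrite le_eqVlt => /predU1P[<-|s0].
  exists (1 / 2); first by rewrite divr_gt0.
  exists 1 => // theta delta _ _ /no_cover_exponent0[].
  by rewrite ltr_pdivrMr// mul1r ltr1n.
(* With this eps the bound N * (eps + eps) is at most 1. *)
exists ((2 * N.+1%:R)^-1); first by rewrite invr_gt0 mulr_gt0.
exists (Num.min 1 (a [::])); first by rewrite lt_min ltr01.
move=> theta delta th01 /andP[d0]; rewrite lt_min => /andP[d1 da] cov.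
have [||C [Cw barC CP sC]] := NP _ _ _ _ s0 _ _ cov.
- by rewrite invr_gt0 mulr_gt0.
- by rewrite d0.
apply: (bar_s_delta th01 _ da Cw barC CP); first by rewrite d0.
apply: le_trans sC _; rewrite lee_fin.
have -> : N%:R * ((2 * N.+1%:R)^-1 + (2 * N.+1%:R)^-1) = N%:R / N.+1%:R :> R.
  by field; rewrite addrC natr1 pnatr_eq0.
by rewrite ler_pdivrMr// mul1r ler_nat.
Qed.

Lemma cover_s_level s : 0 <= s -> exists2 eps, 0 < eps &
  forall m, exists2 Delta, 0 < Delta & forall theta delta,
  0 < delta < Delta -> has_cover E theta s eps delta ->
  exists2 k, (m <= k)%N & s_level n c k <= s.
Proof.
have [N NP] := cover_bar hM hc; have [q q01 cq] := moran_ratio_bd hM hc.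
rewrite le_eqVlt => /predU1P[<-|s0].
  exists (1 / 2); first by rewrite divr_gt0.
  move=> m; exists 1 => // theta delta _ /no_cover_exponent0[].
  by rewrite ltr_pdivrMr// mul1r ltr1n.
have as0 : 0 < a [::] `^ s by rewrite powR_gt0.
(* With this eps the bound N * (eps + eps) is less than |J|^s, which turns the
   sum of the |J_u|^s into one of the c_u^s that is less than 1; a cell smaller
   than Delta belongs to a word longer than m. *)
pose eps := a [::] `^ s / (2 * N.+1%:R).
have eps0 : 0 < eps by rewrite divr_gt0// mulr_gt0.
exists eps => // m; pose Delta := c_star n c ^+ m.+1 * a [::].
have cstar1 := c_star_lt1 hM hc.
have DeltaJ : Delta <= a [::].
  by rewrite ler_piMl ?(ltW a0)// exprn_ile1// ltW.
exists Delta; first by rewrite mulr_gt0// exprn_gt0.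
move=> theta delta /andP[d0 dD] cov.
have [|C [Cw barC CP sC]] := NP _ _ _ _ s0 eps0 _ cov.
  by rewrite d0 (lt_le_trans dD).
have [|u Cu Pu] := bar_level (moran_n_gt0 hM) cq (ltW as0) Cw barC (s := s).
  apply: (@le_lt_trans _ _ (\esum_(u in C) (a u `^ s)%:E)%E).
    apply: le_esum => u /Cw uw; have /andP[wr0 _] := word_ratio_bd cq uw.
    by rewrite lee_fin /a (cell_diamE hM uw) powRM ?(ltW wr0) ?(ltW a0)// mulrC.
  apply: (le_lt_trans sC); rewrite lte_fin.
  have -> : N%:R * (eps + eps) = a [::] `^ s * (N%:R / N.+1%:R).
    have twoN (A M : R) : M != 0 -> N%:R * (A / (2 * M) + A / (2 * M)) = A * (N%:R / M).
      by move=> M0; field.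
    by apply: twoN; rewrite pnatr_eq0.
  by rewrite gtr_pMr// ltr_pdivrMr// mul1r ltr_nat.
have uw := Cw _ Cu.
have mu : (m < size u)%N.
  rewrite ltnNge; apply/negP => um; have [_] := CP u Cu.
  rewrite leNgt => /negP; apply; apply: (lt_le_trans dD).
  rewrite /a (cell_diamE hM)// ler_wpM2r ?(ltW a0)//.
  apply: (@le_trans _ _ (c_star n c ^+ size u)).
    by rewrite ler_wiXn2l ?(ltW hc) ?(ltW cstar1)// leqW.
  rewrite /word_ratio -[X in _ ^+ X]card_ord -prodr_const.
  by apply: ler_prod => i _; rewrite (ltW hc) (c_star_le hM)//; exact: uw.
exists (size u); first exact: ltnW.
by apply: (s_level_le (moran_n_gt0 hM) q01 cq) => //; exact: leq_ltn_trans mu.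
Qed.

End MoranCuts.

(** * From words to covers *)

Section MoranCovers.
Context (R : realType) (d : nat) (n : nat -> nat) (c : nat -> nat -> R)
  (J : set 'rV[R]_d) (Js : seq nat -> set 'rV[R]_d).
Hypothesis hM : moran_structure n c J Js.
Hypothesis hc : 0 < c_star n c.
Implicit Types (u v : seq nat) (w : nat -> nat) (F : seq (seq nat)).
Implicit Types (theta s t eps delta : R) (C M : set (seq nat)).

Let a : seq nat -> R := cell_diam Js.
Let E := moran_set n Js.
Let a0 : 0 < a [::] := cell_diam_gt0 hM (@is_word_nil n).

(** A point of E lies in a cell of level K + 1, but the cells of the different
levels that contain it need not be nested; the bound on the lengths provides a
single word long enough to have a prefix in M. *)
Lemma cut_set_cover M K : cut_set n M -> (forall u, M u -> (size u <= K)%N) ->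
  forall x, E x -> exists2 u, M u & Js u x.
Proof.
move=> [Mw cM] MK x Ex; have [u [uw uK] ux] := Ex K.+1 isT.
have [v [[Mv vE] _]] := cM _ (is_inf_word_nth (moran_n_gt0 hM) uw).
exists v => //; apply: (cell_prefix_sub hM uw _ ux).
have vu : (size v <= size u)%N by rewrite uK leqW// MK.
by rewrite vE -(take_mkseq _ vu) mkseq_nth; exact: prefix_take.
Qed.

(** Cells of a cut set for eta = delta/2 are replaced by closed balls of
diameter b_u = max (2 |J_u|, delta^(1/theta)), which lies in the allowed range
and is at most B |J_u|, since |J_u| >= c_* |J_u*| > c_* eta^(1/theta). *)
Lemma s_delta_has_cover theta s' s eps : 0 < theta <= 1 -> s' < s -> 0 < eps ->
  exists2 Delta, 0 < Delta & forall delta, 0 < delta < Delta ->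
    s_delta n Js theta (delta / 2) <= s' ->
    0 <= s /\ has_cover E theta s eps delta.
Proof.
move=> th01 ss eps0; have /andP[th0 th1] := th01.
pose B := 2 + 2 `^ theta^-1 / c_star n c.
have B0 : 0 < B by rewrite addr_gt0// divr_gt0// powR_gt0.
have B2 : 2 <= B by rewrite lerDl ltW// divr_gt0// powR_gt0.
have Bs : 0 < B `^ s by rewrite powR_gt0.
(* The last bound on delta makes B^s * eta^(s - s') at most eps. *)
exists (Num.min (Num.min 1 (a [::])) ((eps / B `^ s) `^ (s - s')^-1)).
  by rewrite !lt_min ltr01 a0 powR_gt0// divr_gt0.
move=> delta /andP[d0]; rewrite !lt_min => /andP[/andP[d1 da] deps].
set eta := delta / 2 => eta_s'.
have eta0 : 0 < eta by rewrite divr_gt0.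
have eta_delta : eta <= delta by rewrite ler_pdivrMr// ler_peMr ?ler1n// ltW.
have eta01 : 0 < eta < 1 by rewrite eta0 (le_lt_trans eta_delta).
have [[M adM tM] _ t0] := s_deltaP hM hc th01 eta01 (le_lt_trans eta_delta da).
set t := s_delta n Js theta eta in eta_s' tM t0.
have [F [uF ME F0 Fw Fd]] := admissible_cut_seq hM hc th0 eta0 adM.
have s0 : 0 <= s by rewrite (le_trans t0)// (le_trans eta_s')// ltW.
split=> //.
have cell_pt u : exists x, is_word n u -> Js u x.
  have [uw|uw] := pselect (is_word n u); last by exists 0.
  by have [x ux] := cell_neq0 hM uw; exists x.
have [x xP] := choice cell_pt.
pose sigma := scale_root delta theta.
pose b u := Num.max (2 * a u) sigma.
have b_ge u : u \in F -> 2 * a u <= b u by rewrite le_max lexx.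
have b0 u : u \in F -> 0 < b u.
  move=> uF'; apply: lt_le_trans (b_ge u uF').
  by rewrite mulr_gt0//; case/andP: (Fd u uF').
have b_delta u : u \in F -> sigma <= b u <= delta.
  move=> uF'; rewrite le_max lexx orbT ge_max /=; apply/andP; split.
    by rewrite mulrC -ler_pdivlMr//; case/andP: (Fd u uF').
  by apply: scale_root_le; [rewrite (ltW th0)|rewrite d0 ltW].
have b_le u : u \in F -> b u <= B * a u.
  move=> uF'; have au0 : 0 < a u by case/andP: (Fd u uF').
  rewrite ge_max ler_wpM2r ?(ltW au0)//= /B mulrDl.
  rewrite -[leLHS]add0r lerD// ?mulr_ge0// ?(ltW au0)//.
  have uw := Fw u uF'.
  have pu : eta `^ theta^-1 <= a (parent u).
    have [] := adM.2 u; first by rewrite ME.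
    by rewrite (diam_cell hM (is_word_parent uw)) /scale_root gt_eqF// lte_fin => /ltW.
  rewrite /sigma /scale_root gt_eqF//.
  have -> : delta = 2 * eta by rewrite /eta mulrC divfK.
  rewrite powRM ?(ltW eta0)// -mulrA ler_wpM2l ?powR_ge0// mulrC ler_pdivlMr//.
  rewrite mulrC; apply: le_trans (cell_diam_parent hM hc uw).
  by rewrite ler_wpM2l// ltW.
apply: (@has_cover_seq _ _ _ _ _ _ _ _ F
  (fun u => [set y | edist (x u) y <= b u / 2]) b).
- have [K KP] := admissible_cut_size hM hc th0 eta0.
  move=> y /(cut_set_cover adM.1 (KP _ adM))[u]; rewrite ME /= => uF' uy.
  exists u => //=; apply: (@le_trans _ _ (a u)).
    rewrite -lee_fin -(diam_cell hM (Fw u uF')); apply: edist_le_diam => //.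
    exact: xP (Fw u uF').
  by rewrite ler_pdivlMr// mulrC b_ge.
- move=> u uF'; split; last exact: b_delta.
  rewrite diam_closed_ball ?(moran_d_gt0 hM)//; last first.
    by rewrite divr_ge0// ltW// b0.
  by rewrite mulrC divfK.
apply: (@le_trans _ _ (B `^ s * \sum_(u <- F) a u `^ s)).
  rewrite mulr_sumr big_seq [leRHS]big_seq; apply: ler_sum => u uF'.
  have au0 : 0 < a u by case/andP: (Fd u uF').
  rewrite -powRM ?(ltW B0) ?(ltW au0)//.
  by apply: ge0_ler_powR; rewrite ?nnegrE// ?b_le// ?mulr_ge0 ?ltW// b0.
rewrite mulrC -ler_pdivlMr//.
have ts : t <= s by rewrite (le_trans eta_s')// ltW.
apply: (le_trans (powsum_le ts Fd)).
have -> : \sum_(u <- F) a u `^ t = 1.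
  by move: tM; rewrite ME (esum_cells hM)// => -[].
rewrite mulr1; apply: (@le_trans _ _ (eta `^ (s - s'))).
  by rewrite ger_powR ?eta0 ?lerD2l ?lerN2//= ltW//; case/andP: eta01.
have ss0 : 0 < s - s' by rewrite subr_gt0.
rewrite -[leRHS]powRr1 ?divr_ge0 ?(ltW eps0) ?(ltW Bs)//.
rewrite -(@mulVf _ (s - s')) ?gt_eqF// powRrM.
apply: ge0_ler_powR; rewrite ?nnegrE ?powR_ge0 ?(ltW ss0) ?(ltW eta0)//.
exact: le_trans eta_delta (ltW deps).
Qed.

(** The cells of level k have diameter at most q^k |J|, so that every large k
with s_k <= s' gives a cover as fine as wanted. *)
Lemma s_level_has_cover s' s eps delta : s' < s -> 0 < eps -> 0 < delta ->
  exists m, forall k, (m <= k)%N -> s_level n c k <= s' ->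
    0 <= s /\ has_cover E 0 s eps delta.
Proof.
move=> ss eps0 delta0; have [q q01 cq] := moran_ratio_bd hM hc.
have /andP[q0 q1] := q01; have ss0 : 0 < s - s' by rewrite subr_gt0.
have as0 : 0 < a [::] `^ s by rewrite powR_gt0.
have qs01 : 0 < q `^ (s - s') < 1.
  rewrite powR_gt0//=; have := @gt0_ltr_powR R (s - s') ss0 q 1; rewrite powR1.
  by apply; rewrite ?nnegrE// ltW.
have [K KP] := cell_diam_small hM hc delta0.
have [L LP] := exists_expr_le qs01 as0 eps0.
exists (maxn 1 (maxn K L)) => m; rewrite !geq_max => /and3P[m0 Km Lm] ms'.
have n0 := moran_n_gt0 hM.
have qm01 : 0 < q ^+ m < 1 by rewrite exprn_gt0//= exprn_ilt1 ?(ltW q0)// -lt0n.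
have Fw u : u \in words n m -> is_word n u by case/mem_words.
have Fbd u : u \in words n m -> 0 < word_ratio c u <= q ^+ m.
  by move=> /mem_words[uw <-]; have := word_ratio_bd cq uw.
set t := s_level n c m in ms'.
have tF : \sum_(u <- words n m) word_ratio c u `^ t = 1 by exact: (s_levelP n0 q01 cq).
have t0 : 0 <= t.
  have [t' t'0 t'F] := powsum_root (words_neq0 n0 m) qm01 Fbd.
  by apply: le_trans t'0 _; apply: powsum_root_le qm01 Fbd _ t'F; rewrite tF.
have s0 : 0 <= s by rewrite (le_trans t0)// (le_trans ms')// ltW.
split=> //; apply: (@has_cover_seq _ _ _ _ _ _ _ _ (words n m) Js a).
- move=> x Ex; have [u [uw um] ux] := Ex m m0.
  by exists u => //; apply/mem_words.
- move=> u /mem_words[uw um]; rewrite (diam_cell hM uw); split=> //.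
  by rewrite /scale_root eqxx ltW ?(cell_diam_gt0 hM)//= KP// um.
have -> : \sum_(u <- words n m) a u `^ s =
    a [::] `^ s * \sum_(u <- words n m) word_ratio c u `^ s.
  rewrite mulr_sumr big_seq [RHS]big_seq; apply: eq_bigr => u uF.
  have /andP[wr0 _] := Fbd u uF.
  by rewrite /a (cell_diamE hM (Fw u uF)) powRM ?(ltW wr0) ?(ltW a0)// mulrC.
apply: le_trans LP; rewrite mulrC ler_wpM2r ?(ltW as0)//.
have ts : t <= s by rewrite (le_trans ms')// ltW.
apply: (le_trans (powsum_le ts Fbd)); rewrite tF mulr1.
apply: (@le_trans _ _ ((q ^+ m) `^ (s - s'))).
  by apply: ger_powR; rewrite ?lerD2l ?lerN2//; case/andP: qm01 => -> /ltW.
rewrite -[q ^+ m]powR_mulrn ?(ltW q0)// -powRrM mulrC powRrM powR_mulrn ?powR_ge0//.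
by rewrite ler_wiXn2l ?powR_ge0//; case/andP: qs01 => _ /ltW.
Qed.

End MoranCovers.

(** * Upper and lower limits *)

Section LimitsAlongFilters.
Context (R : realType) (T : choiceType) (X : filteredType T)
  (f : X -> R) (F : set (set X)).
Local Open Scope ereal_scope.

Lemma lt_between_EFin (x : \bar R) (s : R) : x < s%:E ->
  exists2 s' : R, (s' < s)%R & x < s'%:E.
Proof.
case: x => [r|//|_]; last by exists (s - 1)%R; rewrite ?ltNyr// ltrBlDr ltrDl.
rewrite lte_fin => rs; exists ((r + s) / 2)%R; first by rewrite (midf_lt rs).
by rewrite lte_fin (midf_lt rs).
Qed.

Lemma limf_esup_lt (s : R) : limf_esup (fun x => (f x)%:E) F < s%:E ->
  exists2 s' : R, (s' < s)%R & exists2 A, F A & forall x, A x -> (f x <= s')%R.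
Proof.
move=> /lt_between_EFin[s' ss' /ereal_inf_lt[_ [A FA <-] lt]].
exists s' => //; exists A => // x Ax; rewrite -lee_fin; apply: le_trans (ltW lt).
by apply: ereal_sup_ubound; exists x.
Qed.

Lemma limf_esup_le (s : R) A : F A -> (forall x, A x -> (f x <= s)%R) ->
  limf_esup (fun x => (f x)%:E) F <= s%:E.
Proof.
move=> FA fs; apply: (@le_trans _ _ (ereal_sup [set (f x)%:E | x in A])).
  by apply: ereal_inf_lbound; exists A.
by apply: ge_ereal_sup => _ [x Ax <-]; rewrite lee_fin fs.
Qed.

Lemma limf_einf_lt (s : R) : limf_einf (fun x => (f x)%:E) F < s%:E ->
  exists2 s' : R, (s' < s)%R & forall A, F A -> exists2 x, A x & (f x <= s')%R.
Proof.
move=> /lt_between_EFin[s' ss' lt]; exists s' => // A FA.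
move: lt; rewrite /limf_einf lteNl => lt.
have : (- s')%:E < ereal_sup ((\- (fun x => (f x)%:E)) @` A).
  by apply: (lt_le_trans lt); apply: ereal_inf_lbound; exists A.
move=> /ereal_sup_gt[_ [x Ax <-]]; rewrite lte_fin ltrN2 => /ltW fx.
by exists x.
Qed.

Lemma limf_einf_le (s : R) : (forall A, F A -> exists2 x, A x & (f x <= s)%R) ->
  limf_einf (fun x => (f x)%:E) F <= s%:E.
Proof.
move=> fs; rewrite /limf_einf leeNl; apply: le_ereal_inf_tmp => _ [A /fs[x Ax fx] <-].
apply: (@le_trans _ _ (- (f x)%:E)); first by rewrite lee_fin lerN2.
by apply: ereal_sup_ubound; exists x.
Qed.

End LimitsAlongFilters.

Lemma ereal_inf_eq (R : realType) (S : set R) (L : \bar R) :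
  (forall s : R, (L < s%:E)%E -> S s) -> (forall s, S s -> (L <= s%:E)%E) ->
  ereal_inf [set s%:E | s in S] = L.
Proof.
move=> LS SL; apply/eqP; rewrite eq_le; apply/andP; split; last first.
  by apply: le_ereal_inf_tmp => _ [s Ss <-]; exact: SL.
rewrite leNgt; apply/negP => lt.
have [s Ls si] : exists2 s : R, (L < s%:E)%E &
    (s%:E < ereal_inf [set s%:E | s in S])%E.
  move: lt; case: (ereal_inf _) => [r /lt_between_EFin[s sr Ls]| |].
  - by exists s.
  - case: (L) => [r _|//|_]; last by exists 0; rewrite ?ltNyr ?ltry.
    by exists (r + 1); rewrite ?ltry// lte_fin ltrDl.
  - by rewrite ltNge leNye.
move: si; rewrite ltNge => /negP; apply; apply: ereal_inf_lbound.
by exists s => //; exact: LS.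
Qed.

(** * The intermediate dimensions *)

Section IntermediateDimensions.
Context (R : realType) (d : nat) (n : nat -> nat) (c : nat -> nat -> R)
  (J : set 'rV[R]_d) (Js : seq nat -> set 'rV[R]_d).
Hypothesis hM : moran_structure n c J Js.
Hypothesis hc : 0 < c_star n c.
Implicit Types (theta s eps delta : R).

Let E := moran_set n Js.

Lemma at_right0P (A : set R) : (0 : R)^'+ A <->
  exists2 e : R, 0 < e & forall x, 0 < x < e -> A x.
Proof.
split.
  move=> /nbhs_ballP[e /= e0 eA]; exists e => // x /andP[x0 xe].
  by apply: eA => //; rewrite /ball/= sub0r normrN gtr0_norm.
move=> [e e0 eA]; apply/nbhs_ballP; exists e => //= x.
rewrite /ball/= sub0r normrN => xe x0; apply: eA; rewrite x0/=.
exact: le_lt_trans (ler_norm x) xe.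
Qed.

(* The properties of s whose infima are the two dimensions. *)
Let covers_at_all_scales theta s := forall eps : R, 0 < eps ->
  exists Delta : R, 0 < Delta /\
    forall delta : R, 0 < delta <= Delta -> has_cover E theta s eps delta.
Let covers_at_small_scales theta s := forall eps Delta : R,
  0 < eps -> 0 < Delta ->
  exists delta : R, 0 < delta <= Delta /\ has_cover E theta s eps delta.

Let all_scales_small theta s :
  covers_at_all_scales theta s -> covers_at_small_scales theta s.
Proof.
move=> h eps Delta eps0 Delta0; have [D [D0 DP]] := h eps eps0.
exists (Num.min D Delta); rewrite lt_min D0 Delta0 ge_min lexx orbT; split=> //.
by apply: DP; rewrite lt_min D0 Delta0 ge_min lexx.
Qed.

Lemma s_star_lt_cover s : (s_star n c < s%:E)%E ->
  0 <= s /\ forall eps delta, 0 < eps -> 0 < delta -> has_cover E 0 s eps delta.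
Proof.
move=> /limf_einf_lt[s' ss' sP].
have cov eps delta : 0 < eps -> 0 < delta -> 0 <= s /\ has_cover E 0 s eps delta.
  move=> eps0 delta0.
  have [m mP] := s_level_has_cover hM hc ss' eps0 delta0.
  have [|k mk ks'] := sP [set k | (m <= k)%N]; first by exists m.
  exact: mP mk ks'.
split; first by have [] := cov 1 1 ltr01 ltr01.
by move=> eps delta eps0 delta0; have [] := cov _ _ eps0 delta0.
Qed.

Lemma cover_s_star_le theta s : 0 <= s -> covers_at_small_scales theta s ->
  (s_star n c <= s%:E)%E.
Proof.
move=> s0 cov; have [eps eps0 epsP] := cover_s_level hM hc s0.
apply: limf_einf_le => A [m _ mA]; have [D D0 DP] := epsP m.
have [||delta [/andP[d0 dD] dcov]] := cov eps (D / 2) => //.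
  by rewrite divr_gt0.
have [|k mk ks] := DP theta delta _ dcov; last by exists k => //; exact: mA.
by rewrite d0 (le_lt_trans dD)// ltr_pdivrMr// ltr_pMr// ltr1n.
Qed.

Lemma idim0 : upper_idim 0 E = s_star n c /\ lower_idim 0 E = s_star n c.
Proof.
split; apply: ereal_inf_eq => s.
- move=> /s_star_lt_cover[s0 cov]; split=> // eps eps0.
  by exists 1; split=> // delta /andP[d0 _]; exact: cov.
- by move=> [s0 /all_scales_small]; exact: cover_s_star_le.
- move=> /s_star_lt_cover[s0 cov]; split=> // eps D eps0 D0.
  by exists D; rewrite D0 lexx; split=> //; exact: cov.
- by move=> [s0]; exact: cover_s_star_le.
Qed.

Lemma upper_idim_pos theta : 0 < theta <= 1 -> upper_idim theta E =
  limf_esup (fun delta => (s_delta n Js theta delta)%:E) (0 : R)^'+.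
Proof.
move=> th01; apply: ereal_inf_eq => s.
  move=> /limf_esup_lt[s' ss' [A /at_right0P[e e0 eA] As']].
  have cov eps : 0 < eps -> exists2 D, 0 < D & forall delta,
      0 < delta <= D -> 0 <= s /\ has_cover E theta s eps delta.
    move=> eps0; have [D D0 DP] := s_delta_has_cover hM hc th01 ss' eps0.
    exists (Num.min D e / 2); first by rewrite divr_gt0// lt_min D0.
    move=> delta /andP[d0]; rewrite ler_pdivlMr// le_min => /andP[dD de].
    have dd : delta < delta * 2 by rewrite ltr_pMr// ltr1n.
    apply: DP; first by rewrite d0 (lt_le_trans dd).
    apply/As'/eA; rewrite divr_gt0//= ltr_pdivrMr//.
    by rewrite (lt_le_trans dd)// (le_trans de)// ler_pMr// ler1n.
  split.
    by have [D D0 /(_ D)] := cov 1 ltr01; rewrite D0 lexx => /(_ isT)[].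
  by move=> eps /cov[D D0 DP]; exists D; split=> // delta /DP[].
move=> [s0 cov]; have [eps eps0 [D0 D0_gt0 D0P]] := cover_s_delta hM hc s0.
have [D1 [D1_gt0 D1P]] := cov eps eps0.
apply: (limf_esup_le (A := [set x | 0 < x < Num.min D0 D1])).
  apply/at_right0P; exists (Num.min D0 D1) => //.
  by rewrite lt_min D0_gt0.
move=> delta /=; rewrite lt_min => /and3P[d0 dD0 /ltW dD1].
by apply: D0P th01 _ _; [rewrite d0|apply: D1P; rewrite d0].
Qed.

Lemma lower_idim_pos theta : 0 < theta <= 1 -> lower_idim theta E =
  limf_einf (fun delta => (s_delta n Js theta delta)%:E) (0 : R)^'+.
Proof.
move=> th01; apply: ereal_inf_eq => s.
  move=> /limf_einf_lt[s' ss' sP].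
  have cov eps D : 0 < eps -> 0 < D -> exists delta,
      0 < delta <= D /\ (0 <= s /\ has_cover E theta s eps delta).
    move=> eps0 D0; have [D1 D10 D1P] := s_delta_has_cover hM hc th01 ss' eps0.
    have [|eta /= /andP[eta0]] := sP [set x | 0 < x < Num.min D1 D / 2].
      apply/at_right0P; exists (Num.min D1 D / 2) => //.
      by rewrite divr_gt0// lt_min D10.
    rewrite ltr_pdivlMr// lt_min => /andP[etaD1 etaD] etas.
    have eta20 : 0 < eta * 2 by rewrite mulr_gt0.
    exists (eta * 2); rewrite eta20 ltW//; split=> //; apply: D1P.
      by rewrite eta20.
    by rewrite mulfK.
  split.
    by have [delta [_ []]] := cov 1 1 ltr01 ltr01.
  move=> eps D eps0 D0; have [delta [dD [_ dcov]]] := cov eps D eps0 D0.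
  by exists delta.
move=> [s0 cov]; have [eps eps0 [D0 D0_gt0 D0P]] := cover_s_delta hM hc s0.
apply: limf_einf_le => A /at_right0P[e e0 eA].
have m0 : 0 < Num.min D0 e / 2 by rewrite divr_gt0// lt_min D0_gt0.
have [delta [/andP[d0 dm] dcov]] := cov _ _ eps0 m0.
have : delta < Num.min D0 e.
  by rewrite (le_lt_trans dm)// ltr_pdivrMr// ltr_pMr ?ltr1n// lt_min D0_gt0.
rewrite lt_min => /andP[dD0 de].
exists delta; first by apply: eA; rewrite d0.
by apply: D0P th01 _ dcov; rewrite d0.
Qed.

End IntermediateDimensions.

Theorem theorem1p2 (R : realType) (d : nat) (n : nat -> nat)
    (c : nat -> nat -> R) (J : set 'rV[R]_d) (Js : seq nat -> set 'rV[R]_d)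
    (hM : moran_structure n c J Js) (hc : 0 < c_star n c)
    (theta : R) (htheta : 0 <= theta <= 1) :
  upper_idim theta (moran_set n Js) = s_upper n c Js theta /\
  lower_idim theta (moran_set n Js) = s_lower n c Js theta.
Proof.
rewrite /s_upper /s_lower; case: eqVneq => [->|th_neq0].
  exact: (idim0 hM hc).
have th01 : 0 < theta <= 1.
  by have /andP[th0 ->] := htheta; rewrite lt_def th_neq0 th0.
by split; [exact: (upper_idim_pos hM hc)|exact: (lower_idim_pos hM hc)].
Qed.
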